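(* Let $k\ge3$, $\theta\in\mathcal{P}(B)$ and $t\in V_1\otimes\cdots\otimes V_k$ a complex tensor. Then $E^\theta(t)\ge E_\theta(t)$ (for any fixed ordering of $\operatorname{supp}\theta$ used in the definition of $E^\theta$).
   Context: All vector spaces are finite-dimensional complex; $[k]=\{1,\dots,k\}$, $\overline S=[k]\setminus S$, $V_S=\bigotimes_{j\in S}V_j$; $B$ is the set of bipartitions $\{S,\overline S\}$ of $[k]$ ($S,\overline S$ nonempty), $\mathcal{P}(B)$ the probability distributions on $B$. $H$ is Shannon entropy base 2 or von Neumann entropy $-\operatorname{Tr}\rho\log_2\rho$; for $\lambda\vdash n$, $\overline\lambda=(\lambda_1/n,\lambda_2/n,\dots)$. Schur–Weyl: $V^{\otimes n}\cong\bigoplus_{\lambda\vdash n}\mathbb{S}_\lambda(V)\otimes[\lambda]$ as $\mathrm{GL}(V)\times S_n$-modules; $P^V_\lambda$ is the equivariant projection onto the $\lambda$-isotypic component. For $S\subseteq[k]$, under $(V_{[k]})^{\otimes n}\cong(V_S)^{\otimes n}\otimes(V_{\overline S})^{\otimes n}$ let $P^{V_S}_\lambda$ act as $P^{V_S}_\lambda\otimes\mathrm{Id}$; with the symmetriser $P^{V_{[k]}}_{(n)}=\frac1{n!}\sum_{\pi\in S_n}\pi$, set $P^{V_b}_\lambda=P^{V_S}_\lambda P^{V_{[k]}}_{(n)}$ for $b=\{S,\overline S\}$. Upper quantum functional: list $\operatorname{supp}\theta=\{b_1,\dots,b_\ell\}$ in a fixed order; $E^\theta(t)=\sup\sum_{i}\theta(b_i)H(\overline{\lambda^{(b_i)}})$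 over all $n\ge1$ and partitions $\lambda^{(b_i)}\vdash n$ with $P^{V_{b_\ell}}_{\lambda^{(b_\ell)}}\cdots P^{V_{b_1}}_{\lambda^{(b_1)}}t^{\otimes n}\ne0$. Lower quantum functional: with inner products on the $V_j$, for nonzero $\psi$ let $\rho=|\psi\rangle\langle\psi|/\langle\psi|\psi\rangle$, $\rho_S$ its marginal on $V_S$, $H_\theta(\psi)=\sum_{\{S,\overline S\}\in B}\theta(\{S,\overline S\})H(\rho_S)$, and $E_\theta(t)=\sup_{A_j\in\mathrm{GL}(V_j)}H_\theta((A_1\otimes\cdots\otimes A_k)t)$ ($E^\theta(0)=E_\theta(0)=-\infty$). *)

(* Defs.v *)
From HB Require Import structures.
From mathcomp Require Import boolp classical_sets reals ereal exp.
From mathcomp Require Import all_boot all_order all_fingroup all_algebra.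
From mathcomp Require Import complex spectral.

Set Implicit Arguments.
Unset Strict Implicit.
Unset Printing Implicit Defensive.

Import Order.TTheory GRing.Theory Num.Theory.
Local Open Scope ring_scope.
Local Open Scope complex_scope.

(** * Entropies *)

(* [ln x = 0] for [x <= 0], so that [0 * log2 0 = 0]. *)
Definition log2 (R : realType) (x : R) : R := ln x / ln 2.

Definition is_part (n : nat) (la : seq nat) : bool :=
  [&& sorted geq la, 0%N \notin la & sumn la == n].

(* Shannon entropy of [la / n]. *)
Definition shannon_part (R : realType) (n : nat) (la : seq nat) : R :=
  - \sum_(i <- la) (i%:R / n%:R) * log2 (i%:R / n%:R).

(* [log2] of a Hermitian matrix by functional calculus; its value on the kernel
   is immaterial in [vN_entropy]. *)
Definition mxlog2 (R : realType) (m : nat) (rho : 'M[R[i]]_m) : 'M[R[i]]_m :=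
  invmx (spectralmx rho)
  *m diag_mx (map_mx (fun z : R[i] => (log2 (complex.Re z))%:C)
                (spectral_diag rho))
  *m spectralmx rho.

Definition vN_entropy (R : realType) (m : nat) (rho : 'M[R[i]]_m) : R :=
  complex.Re (- \tr (rho *m mxlog2 rho)).

(** * Tensor powers and isotypic projections *)

(* The complex vector space with basis [X]. *)
Definition cspace (R : realType) (X : finType) := {ffun X -> R[i]^o}.

(* The [n]-th tensor power of [cspace R X]. *)
Definition tpow (R : realType) (X : finType) (n : nat) :=
  cspace R {ffun 'I_n -> X}.

Section Isotypic.
Variables (R : realType) (n : nat).
Local Notation C := (R[i]).

(* [sact p] sends the basis vector [e_x] to [e_(x \o p^-1)]: a left action for
   composition of permutations.  Composition is the opposite of the product
   [*%g] of ['S_n]: [(p \o q) i = (q * p)%g i]. *)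
Definition sact (X : finType) (p : 'S_n) (T : tpow R X n) : tpow R X n :=
  [ffun x : {ffun 'I_n -> X} => T [ffun i => x (p i)]].

(* [g^{(x) n}] *)
Definition glact (X : finType) (g : 'M[C]_#|X|) (T : tpow R X n) : tpow R X n :=
  [ffun x : {ffun 'I_n -> X} => \sum_(y : {ffun 'I_n -> X})
     (\prod_i g (enum_rank (x i)) (enum_rank (y i))) * T y].

Definition galg := cspace R 'S_n.

(* Left translation, again for the composition product. *)
Definition galg_act (p : 'S_n) (a : galg) : galg :=
  [ffun s => a (s * p^-1)%g].

Definition galg_mul (a b : galg) : galg :=
  [ffun s => \sum_p a p * b (s * p^-1)%g].

(* The boxes of the Young diagram of [la] are numbered row by row:
   [reshape_index la i] and [reshape_offset la i] are the row and the column of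
   the box with number [i]. *)
Definition row_stab (la : seq nat) (p : 'S_n) : bool :=
  [forall i : 'I_n, reshape_index la (p i) == reshape_index la i].

Definition col_stab (la : seq nat) (p : 'S_n) : bool :=
  [forall i : 'I_n, reshape_offset la (p i) == reshape_offset la i].

Definition young_sym (la : seq nat) : galg :=
  [ffun s => \sum_(p | row_stab la p) \sum_(q | col_stab la q)
     (-1) ^+ (odd_perm q) * (s == (q * p)%g)%:R].

(* The module [[la]], as the left ideal generated by the Young symmetriser. *)
Definition specht (la : seq nat) (a : galg) : Prop :=
  exists b : galg, a = galg_mul b (young_sym la).

(* The restriction of [f] to [[la]] is a morphism of representations. *)
Definition specht_hom (X : finType) (la : seq nat)
    (f : 'Hom(galg, tpow R X n)) : Prop :=
  forall p a, specht la a -> f (galg_act p a) = sact p (f a).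

(* The sum of the images of all morphisms from [[la]] to the tensor power. *)
Definition isotypic (X : finType) (la : seq nat) (T : tpow R X n) : Prop :=
  exists (m : nat) (f : 'I_m -> 'Hom(galg, tpow R X n)) (a : 'I_m -> galg),
    (forall i, specht_hom la (f i) /\ specht la (a i))
    /\ T = \sum_(i < m) f i (a i).

Definition is_isoproj (X : finType) (la : seq nat) (P : 'End(tpow R X n)) :
    Prop :=
  [/\ forall p T, P (sact p T) = sact p (P T),
      forall g T, g \in unitmx -> P (glact g T) = glact g (P T),
      (P \o P)%VF = P
    & forall T, T \in limg P <-> isotypic la T].

Definition isoproj (X : finType) (la : seq nat) : 'End(tpow R X n) :=
  xget 0 [set P | is_isoproj la P]%classic.

Definition symmetriser (X : finType) (T : tpow R X n) : tpow R X n :=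
  (n`!%:R : C)^-1 *: \sum_p sact p T.

End Isotypic.

(* The equivariant projection exists and is unique, so the choice made in
   [isoproj] is a definite description. *)

Section IsoprojSpec.
Variables (R : realType) (n : nat) (X : finType) (la : seq nat).
Local Notation C := (R[i]).
Local Notation W := (tpow R X n).

Fact sact_linear (p : 'S_n) : linear (@sact R n X p).
Proof. by move=> a u v; apply/ffunP => x; rewrite !ffunE. Qed.
HB.instance Definition _ p :=
  GRing.isLinear.Build C W W _ (@sact R n X p) (sact_linear p).

Fact glact_linear g : linear (@glact R n X g).
Proof.
move=> a u v; apply/ffunP => x; rewrite !ffunE scaler_sumr -big_split /=.
by apply: eq_bigr => y _; rewrite !ffunE mulrDr /GRing.scale /= mulrCA.
Qed.
HB.instance Definition _ g :=
  GRing.isLinear.Build C W W _ (@glact R n X g) (glact_linear g).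

Lemma sact1 (T : W) : sact 1 T = T.
Proof.
apply/ffunP => x; rewrite !ffunE; congr (T _).
by apply/ffunP => i; rewrite ffunE perm1.
Qed.

Lemma sactM (p q : 'S_n) (T : W) : sact p (sact q T) = sact (q * p)%g T.
Proof.
apply/ffunP => x; rewrite !ffunE; congr (T _).
by apply/ffunP => i; rewrite !ffunE permM.
Qed.

Lemma glact_sact g p (T : W) : glact g (sact p T) = sact p (glact g T).
Proof.
apply/ffunP => x; rewrite !ffunE.
pose h (q : 'S_n) (y : {ffun 'I_n -> X}) : {ffun 'I_n -> X} :=
  [ffun i => y (q i)].
have hK q : cancel (h q) (h q^-1)%g.
  by move=> y; apply/ffunP => i; rewrite !ffunE permKV.
have hbij : bijective (h p) by exists (h p^-1)%g => //; rewrite -{2}(invgK p).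
rewrite [RHS](reindex (h p)) /=; last exact: onW_bij.
apply: eq_bigr => y _; rewrite ffunE; congr (_ * _).
rewrite (reindex_inj (@perm_inj _ p)) /=.
by apply: eq_bigr => i _; rewrite !ffunE.
Qed.

Definition avg (f : 'End(W)) : 'End(W) :=
  (n`!%:R : C)^-1 *: \sum_(p : 'S_n)
    (linfun (@sact R n X p^-1) \o f \o linfun (@sact R n X p))%VF.

Lemma avgE f (T : W) : 
  avg f T = (n`!%:R : C)^-1 *: \sum_(p : 'S_n) sact p^-1 (f (sact p T)).
Proof.
rewrite /avg scale_lfunE sum_lfunE; congr (_ *: _); apply: eq_bigr => p _.
by rewrite !comp_lfunE !lfunE.
Qed.

Lemma nfact0 : (n`!%:R : C) != 0.
Proof. by rewrite pnatr_eq0 -lt0n fact_gt0. Qed.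

Lemma sum_const (T : W) : (n`!%:R : C)^-1 *: (\sum_(p : 'S_n) T) = T.
Proof.
rewrite sumr_const card_Sn -(scaler_nat n`! (T : W)) scalerA mulVf ?scale1r //.
Qed.

Lemma avg_sact f q T : avg f (sact q T) = sact q (avg f T).
Proof.
rewrite !avgE linearZ /=; congr (_ *: _).
rewrite [RHS]linear_sum /= [RHS](reindex_inj (@mulgI _ q)) /=.
apply: eq_bigr => p _.
by rewrite !sactM invMg -mulgA mulVg mulg1.
Qed.

Definition sequiv (h : W -> W) := forall p T, h (sact p T) = sact p (h T).

Lemma equiv_inv (h : 'End(W)) : sequiv h ->
  exists s : 'End(W), sequiv s /\ forall T, h (s (h T)) = h T.
Proof.
move=> hh; exists (avg h^-1%VF); split; first by move=> p T; exact: avg_sact.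
move=> T; rewrite avgE linearZ linear_sum /=.
rewrite (eq_bigr (fun=> h T)) ?sum_const // => p _.
rewrite hh -(hh p T) limg_lfunVK ?memv_img ?memvf // hh sactM mulgV sact1 //.
Qed.

Lemma isotypic0 : @isotypic R n X la 0.
Proof. by exists 0%N, (fun=> 0), (fun=> 0); split=> [[]//|]; rewrite big_ord0. Qed.

Lemma isotypicD (T U : W) : isotypic la T -> isotypic la U -> isotypic la (T + U).
Proof.
move=> [m [f [a [fa ->]]]] [m' [g [b [gb ->]]]].
exists (m + m')%N, (fun i => match split i with inl j => f j | inr j => g j end),
  (fun i => match split i with inl j => a j | inr j => b j end); split.
  by move=> i; case: split => j; [exact: fa | exact: gb].
rewrite big_split_ord /=; congr (_ + _); apply: eq_bigr => i _.
  by rewrite (unsplitK (inl i)).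
by rewrite (unsplitK (inr i)).
Qed.

Lemma isotypic_im (h : 'End(W)) T : sequiv h -> isotypic la T -> isotypic la (h T).
Proof.
move=> hh [m [f [a [fa ->]]]]; exists m, (fun i => h \o f i)%VF, a; split.
  move=> i; have [fi ai] := fa i; split=> // p b sb.
  by rewrite !comp_lfunE fi // hh.
by rewrite linear_sum; apply: eq_bigr => i _; rewrite comp_lfunE.
Qed.

Lemma isotypicZ c (T : W) : isotypic la T -> isotypic la (c *: T).
Proof.
have -> : c *: T = (c *: \1%VF : 'End(W)) T by rewrite scale_lfunE id_lfunE.
by apply: isotypic_im => p U; rewrite !scale_lfunE !id_lfunE linearZ.
Qed.

Lemma isotypic_vs : exists U : {vspace W}, forall T, T \in U <-> isotypic la T.
Proof.
pose Q m := `[< exists U : {vspace W},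
  (forall T, T \in U -> isotypic la T) /\ \dim U = m >].
have exQ : exists m, Q m.
  exists 0%N; apply/asboolP; exists 0%VS; split; last exact: dimv0.
  by move=> T; rewrite memv0 => /eqP ->; exact: isotypic0.
have ubQ m : Q m -> (m <= \dim {: W})%N.
  by move=> /asboolP[U [_ <-]]; rewrite dimvS ?subvf.
case: (ex_maxnP exQ ubQ) => m /asboolP[U [UI dU]] mmax.
exists U => T; split; first exact: UI.
move=> IT; apply/negPn/negP => TU.
have : Q (\dim (U + <[T]>)).
  apply/asboolP; exists (U + <[T]>)%VS; split=> // V /memv_addP[u uU [v]].
  by move=> /vlineP[c ->] ->; apply: isotypicD; [exact: UI | exact: isotypicZ].
move=> /mmax; rewrite -dU => /(conj (addvSl U <[T]>%VS)) /andP.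
rewrite -eqEdim => /eqP UE; case/negP: TU.
by rewrite UE (subvP (addvSr _ _)) ?memv_line.
Qed.


Lemma isoproj_exists : exists P, @is_isoproj R n X la P.
Proof.
have [U UI] := isotypic_vs.
have Us p T : T \in U -> sact p T \in U.
  move=> /UI[m [f [a [fa ->]]]]; apply/UI.
  exists m, f, (fun i => galg_act p (a i)); split.
    move=> i; have [fi [b ab]] := fa i; split=> //; exists (galg_act p b).
    rewrite ab; apply/ffunP => s; rewrite !ffunE.
    rewrite [RHS](reindex_inj (@mulIg _ p)) /=; apply: eq_bigr => q _.
    by rewrite !ffunE mulgK invMg mulgA.
  rewrite linear_sum /=; apply: eq_bigr => i _; have [fi ai] := fa i.
  by rewrite fi.
pose P := avg (projv U).
have PU T : P T \in U.
  rewrite /P avgE memvZ // memv_suml // => p _; apply: Us; exact: memv_proj.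
have Pid T : T \in U -> P T = T.
  move=> TU; rewrite /P avgE (eq_bigr (fun=> T)) ?sum_const // => p _.
  by rewrite projv_id ?Us // sactM mulgV sact1.
have Peq : sequiv P by move=> p T; exact: avg_sact.
exists P; split=> //.
- move=> g T _; pose G := linfun (@glact R n X g).
  have GE V : G V = glact g V by rewrite lfunE.
  have Geq : sequiv G by move=> p V; rewrite !GE glact_sact.
  have GU V : V \in U -> G V \in U by move=> /UI VI; apply/UI/isotypic_im.
  pose h := (P \o G \o (\1 - P))%VF.
  have hE V : h V = P (G (V - P V)) by rewrite !comp_lfunE add_lfunE opp_lfunE id_lfunE.
  have heq : sequiv h.
    by move=> p V; rewrite !hE Peq -linearB /= Geq Peq.
  have [s [seq sh]] := equiv_inv heq.
  have h0 V : h V = 0.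
    rewrite -sh; have /UI hI : h V \in U by rewrite hE PU.
    have sU : s (h V) \in U by apply/UI/isotypic_im.
    by rewrite hE (Pid _ sU) subrr !linear0.
  have := h0 T; rewrite hE !linearB /= => /eqP; rewrite subr_eq0 !GE => /eqP ->.
  by rewrite -!GE (Pid (G (P T))) ?GU.
- by apply/lfunP => T; rewrite comp_lfunE Pid.
- move=> T; rewrite -UI; split=> [/memv_imgP[V _ ->]//|TU].
  by rewrite -(Pid _ TU) memv_img ?memvf.
Qed.

Lemma isoproj_uniq P Q : @is_isoproj R n X la P -> is_isoproj la Q -> P = Q.
Proof.
move=> [Peq _ PP PI] [Qeq _ QQ QI].
have PE T : P (P T) = P T by rewrite -comp_lfunE PP.
have QE T : Q (Q T) = Q T by rewrite -comp_lfunE QQ.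
have Pid T : isotypic la T -> P T = T.
  by move=> /PI/memv_imgP[V _ ->].
have Qid T : isotypic la T -> Q T = T.
  by move=> /QI/memv_imgP[V _ ->].
pose h := (P \o (\1 - Q))%VF.
have hE V : h V = P (V - Q V) by rewrite !comp_lfunE add_lfunE opp_lfunE id_lfunE.
have heq : sequiv h.
  by move=> p V; rewrite !hE Qeq -linearB /= Peq.
have [s [seq sh]] := equiv_inv heq.
apply/lfunP => T; have h0 : h T = 0.
  rewrite -sh; have hI : isotypic la (h T).
    by apply/PI; rewrite hE memv_img ?memvf.
  have sI : isotypic la (s (h T)) by exact: isotypic_im.
  by rewrite hE (Qid _ sI) subrr !linear0.
move: h0; rewrite hE linearB /= => /eqP; rewrite subr_eq0 => /eqP ->.
by rewrite Pid //; apply/QI; rewrite memv_img ?memvf.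
Qed.

Lemma isoprojP : is_isoproj la (isoproj R n X la).
Proof. exact: xgetPex isoproj_exists. Qed.

End IsoprojSpec.

(** * Tensors with k legs *)

Section Legs.
Variables (R : realType) (k : nat) (d : 'I_k -> nat).
Local Notation C := (R[i]).

Definition idx := {dffun forall j : 'I_k, 'I_(d j)}.

Definition idxS (S : {set 'I_k}) :=
  {dffun forall j : {j : 'I_k | j \in S}, 'I_(d (val j))}.

Definition resS (S : {set 'I_k}) (x : idx) : idxS S := [ffun j => x (val j)].

Fact notin_setC (S : {set 'I_k}) (j : 'I_k) : j \notin S -> j \in ~: S.
Proof. by rewrite inE. Qed.

Definition glue (S : {set 'I_k}) (x : idxS S) (y : idxS (~: S)) : idx :=
  [ffun j => match boolP (j \in S) with
             | AltTrue h => x (exist _ j h)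
             | AltFalse h => y (exist _ j (notin_setC h))
             end].

(* The tensor product of the spaces [C^(d j)]. *)
Definition tensor := cspace R idx.

(* [P (x) Id], along the splitting of the [n]-th tensor power given by [glue]. *)
Definition ext_id (n : nat) (S : {set 'I_k})
    (P : 'End(tpow R (idxS S) n)) (T : tpow R idx n) : tpow R idx n :=
  [ffun z : {ffun 'I_n -> idx} =>
     P [ffun x : {ffun 'I_n -> idxS S} =>
          T [ffun i => glue (x i) (resS (~: S) (z i))]]
       [ffun i => resS S (z i)]].

Definition tensor_pow (n : nat) (t : tensor) : tpow R idx n :=
  [ffun x : {ffun 'I_n -> idx} => \prod_i t (x i)].

Definition bipartition :=
  {b : {set {set 'I_k}} | partition b [set: 'I_k]%SET && (#|b| == 2%N)}.

(* A block of [b].  Both blocks give the same [bproj] and the same entropy of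
   the marginal. *)
Definition side (b : bipartition) : {set 'I_k} :=
  odflt finset.set0 [pick S in val b].

Definition bproj (n : nat) (b : bipartition) (la : seq nat)
    (T : tpow R idx n) : tpow R idx n :=
  ext_id (isoproj R n (idxS (side b)) la) (symmetriser T).

Definition is_prob (theta : {ffun bipartition -> R}) : Prop :=
  (forall b, 0 <= theta b) /\ \sum_b theta b = 1.

Definition E_upper (theta : {ffun bipartition -> R}) (s : seq bipartition)
    (t : tensor) : \bar R :=
  if t == 0 then -oo%E else
  ereal_sup [set e | exists (n : nat) (la : bipartition -> seq nat),
    [/\ (1 <= n)%N,
        forall b, b \in s -> is_part n (la b),
        foldl (fun T b => bproj b (la b) T) (tensor_pow n t) s != 0
      & e = (\sum_(b <- s) theta b * shannon_part R n (la b))%:E]]%classic.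

Definition density (psi : tensor) (x y : idx) : C :=
  psi x * conjc (psi y) / \sum_z psi z * conjc (psi z).

Definition marginal (psi : tensor) (S : {set 'I_k}) : 'M[C]_#|{: idxS S}| :=
  \matrix_(a, b) \sum_(c : idxS (~: S))
    density psi (glue (enum_val a) c) (glue (enum_val b) c).

Definition H_theta (theta : {ffun bipartition -> R}) (psi : tensor) : R :=
  \sum_b theta b * vN_entropy (marginal psi (side b)).

Definition local_act (A : forall j, 'M[C]_(d j)) (t : tensor) : tensor :=
  [ffun x : idx => \sum_(y : idx) (\prod_j A j (x j) (y j)) * t y].

Definition E_lower (theta : {ffun bipartition -> R}) (t : tensor) : \bar R :=
  if t == 0 then -oo%E else
  ereal_sup [set e | exists A : forall j, 'M[C]_(d j),
    (forall j, A j \in unitmx)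
    /\ e = (H_theta theta (local_act A t))%:E]%classic.

End Legs.

(* Main.v *)
(** Fix an invertible [A] and put [psi = A t].  The tensor powers of [A] commute
    with the isotypic projections, so it suffices to find partitions with
    [H(la/n) >= H(rho_S) - eps] for which the iterated projection of
    [psi^{(x) n}] does not vanish.

    On [V_S^{(x) n}] the isotypic projections are orthogonal projections that
    add up to the identity: they are the actions of central elements [e_la] of
    the group algebra of [S_n], multiples of the averaged Young symmetrisers.
    The latter annihilate each other because of dominance, hence are linearly
    independent class functions, and there are as many of them as cycle types.

    The range of the projection for [la] has dimension at most
    [2^{n H(la/n)}] times a polynomial in [n].  On the other hand
    [rho_S^{(x) n}] puts, up to an exponentially small error, weight at most
    [2^{-n (H(rho_S) - delta)}] on each vector of its eigenbasis.  So the
    partitions with [H(la/n) <= H(rho_S) - eps] carry a total weight tending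
    to [0], the projection onto the other isotypic components moves
    [psi^{(x) n}] arbitrarily little, and so does the product of these
    projections over the bipartitions in the support of [theta]. *)

Require Import Defs.
From HB Require Import structures.
From mathcomp Require Import boolp classical_sets reals ereal sequences exp.
From mathcomp Require Import all_boot all_order all_fingroup all_algebra.
From mathcomp Require Import complex spectral ring lra.

Set Implicit Arguments.
Unset Strict Implicit.
Unset Printing Implicit Defensive.

Import Order.TTheory GRing.Theory Num.Theory.

(** * Cycle types *)

Section CycleType.
Variable n : nat.
Implicit Types p q : 'S_n.

Definition orbits_by_size p : seq (seq 'I_n) :=
  sort (fun u v => size v <= size u) [seq fingraph.orbit p x | x <- enum (froots p)].

Definition cycle_type p : seq nat := shape (orbits_by_size p).

Lemma orbits_by_sizeP p u :
  u \in orbits_by_size p -> exists x, u = fingraph.orbit p x.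
Proof. by rewrite mem_sort => /mapP[x _ ->]; exists x. Qed.

(** Distinct roots have disjoint orbits, and every point lies in the orbit of its own root. *)
Lemma perm_flatten_orbits p : perm_eq (flatten (orbits_by_size p)) (enum 'I_n).
Proof.
have sym : connect_sym (frel p) by exact/fconnect_sym/perm_inj.
apply: (@perm_trans _ (flatten [seq fingraph.orbit p x | x <- enum (froots p)])).
  by apply: perm_flatten; rewrite perm_sort.
apply: uniq_perm; rewrite ?enum_uniq //; last first.
  move=> x; rewrite mem_enum; apply/flattenP => /=.
  exists (fingraph.orbit p (froot p x)).
    by apply: map_f; rewrite mem_enum; apply: roots_root.
  by rewrite -fconnect_orbit sym connect_root.
have : {subset enum (froots p) <= froots p} by move=> x; rewrite mem_enum.
elim: (enum _) (enum_uniq (froots p)) => //= x s IHs /andP[xs us] sub.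
rewrite cat_uniq orbit_uniq IHs ?andbT //=; last first.
  by move=> y ys; apply: sub; rewrite inE ys orbT.
apply/hasPn => y /flattenP[_ /mapP[z zs ->]]; rewrite -!fconnect_orbit => zy.
apply/negP => xy; case/negP: xs.
have /eqP xx : froots p x by apply: sub; rewrite inE eqxx.
have /eqP zz : froots p z by apply: sub; rewrite inE zs orbT.
suff : froot p x == froot p z by rewrite xx zz => /eqP ->.
by rewrite (root_connect sym) (connect_trans xy) // sym.
Qed.

Lemma size_flatten_orbits p : size (flatten (orbits_by_size p)) = n.
Proof. by rewrite (perm_size (perm_flatten_orbits p)) size_enum_ord. Qed.

Lemma sumn_cycle_type p : sumn (cycle_type p) = n.
Proof. by rewrite -size_flatten size_flatten_orbits. Qed.

Lemma cycle_type_is_part p :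
  [&& sorted geq (cycle_type p), 0 \notin cycle_type p & sumn (cycle_type p) == n].
Proof.
rewrite sumn_cycle_type eqxx andbT; apply/andP; split.
  rewrite /cycle_type /shape sorted_map; apply: sort_sorted => u v.
  exact: leq_total.
apply/negP => /mapP[u /orbits_by_sizeP[x ->]].
by rewrite size_orbit => e; have := fingraph.order_gt0 p x; rewrite -e.
Qed.

(* The successor of position [i] when [0, ..., n.-1] is cut into consecutive
   cycles of lengths [la]. *)
Definition next_pos (la : seq nat) (i : nat) : nat :=
  let r := reshape_index la i in
  let c := reshape_offset la i in
  flatten_index la r (if c.+1 < nth 0 la r then c.+1 else 0).

(** Each block of the flattened list has the form x, p x, p^2 x, ..., so [p] moves to the next entry
    and, at the end of a block, back to its start by [iter_order]. The new position depends on [p]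
    only through its cycle type. *)
Lemma perm_nth_flatten p x0 i : i < n ->
  p (nth x0 (flatten (orbits_by_size p)) i) =
  nth x0 (flatten (orbits_by_size p)) (next_pos (cycle_type p) i).
Proof.
move=> ltin; rewrite /next_pos; set la := cycle_type p.
have lti : i < sumn la by rewrite sumn_cycle_type.
have := reshape_offsetP lti; have := reshape_indexP lti.
set r := reshape_index la i; set c := reshape_offset la i => ltr ltc.
set c' := if _ then _ else _.
have ltc' : c' < nth 0 la r by rewrite /c'; case: ifP => // _; apply: leq_trans ltc.
rewrite !nth_flatten -/la -/r -/c flatten_indexKl // flatten_indexKr //.
have [x ux] : exists x, nth [::] (orbits_by_size p) r = fingraph.orbit p x.
  by apply: (@orbits_by_sizeP p); rewrite mem_nth //; move: ltr; rewrite size_map.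
have lar : nth 0 la r = fingraph.order p x.
  rewrite /la /cycle_type /shape (nth_map [::]) ?ux ?size_orbit //.
  by move: ltr; rewrite size_map.
rewrite ux; move: ltc ltc'; rewrite /c' lar => ltc.
have nthx j : j < fingraph.order p x ->
    nth x0 (fingraph.orbit p x) j = iter j p x.
  by move=> ltj; rewrite (set_nth_default x) ?size_orbit // nth_traject.
rewrite (nthx c) // -iterS.
case: ifP => [ltSc _|ltSc ox]; first by rewrite nthx.
have -> : c.+1 = fingraph.order p x by apply/eqP; rewrite eqn_leq ltc leqNgt ltSc.
rewrite nthx //=; apply: iter_order; exact: perm_inj.
Qed.

(** Sending each entry of the flattened orbit list of [p] to the entry of that of [q] at the same
    position conjugates one into the other, since both move positions by the same [next_pos]. *)
Lemma cycle_type_conj p q : cycle_type p = cycle_type q ->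
  exists g, q = (p ^ g)%g.
Proof.
move=> pq; pose L (s : 'S_n) x0 i := nth x0 (flatten (orbits_by_size s)) i.
have uL s : uniq (flatten (orbits_by_size s)).
  by rewrite (perm_uniq (perm_flatten_orbits s)) enum_uniq.
have inL s x : x \in flatten (orbits_by_size s).
  by rewrite (perm_mem (perm_flatten_orbits s)) mem_enum.
pose g0 (x : 'I_n) := L q x (index x (flatten (orbits_by_size p))).
have idx s (x : 'I_n) : index x (flatten (orbits_by_size s)) < n.
  by rewrite -[X in _ < X](size_flatten_orbits s) index_mem.
have g0_inj : injective g0.
  move=> x y; rewrite /g0 /L => /eqP.
  rewrite (set_nth_default x y) ?size_flatten_orbits //.
  rewrite nth_uniq ?size_flatten_orbits // => /eqP e.
  by rewrite -(nth_index x (inL p x)) e nth_index.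
exists (perm g0_inj).
suff e x : q (g0 x) = g0 (p x).
  by apply/permP => x; rewrite -[x](permKV (perm g0_inj)) permJ !permE e.
rewrite /g0 /L perm_nth_flatten // -pq.
set i := index x _; have ltin : i < n by exact: idx.
have px : p x = nth x (flatten (orbits_by_size p)) (next_pos (cycle_type p) i).
  by rewrite -perm_nth_flatten // nth_index.
have ltn' : next_pos (cycle_type p) i < n.
  rewrite /next_pos -[X in _ < X](sumn_cycle_type p); apply: flatten_indexP.
  have : i < sumn (cycle_type p) by rewrite sumn_cycle_type.
  by move/reshape_offsetP; case: ifP => // _; apply: leq_trans.
rewrite [in RHS]px index_uniq ?size_flatten_orbits //.
by apply: set_nth_default; rewrite size_flatten_orbits.
Qed.

End CycleType.

(** * Dominance of partitions *)

Section Dominance.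
Variable n : nat.
Implicit Types la mu : seq nat.

Lemma reshape_offset_le la i : reshape_offset la i <= i.
Proof. exact: leq_subr. Qed.

Lemma sumn_take_le la r s : r <= s -> sumn (take r la) <= sumn (take s la).
Proof.
by move=> rs; rewrite -(subnKC rs) takeD sumn_cat leq_addr.
Qed.

Lemma sumn_take_S la r : sumn (take r.+1 la) = sumn (take r la) + nth 0 la r.
Proof.
have [ltr|ler] := ltnP r (size la).
  by rewrite (take_nth 0) // sumn_rcons.
by rewrite !take_oversize ?nth_default ?addn0 // leqW.
Qed.

Lemma reshape_index_lt la i r : i < sumn la ->
  (reshape_index la i < r) = (i < sumn (take r la)).
Proof.
move=> lti; have := reshape_offsetP lti; have := reshape_indexK la i.
rewrite /flatten_index; set k := reshape_index la i => e ltc; apply/idP/idP.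
  move/(@sumn_take_le la); apply: leq_trans.
  by rewrite sumn_take_S -[X in X < _]e ltn_add2l.
apply: contraLR; rewrite -!leqNgt => /(@sumn_take_le la) le_rk.
by apply: leq_trans le_rk _; rewrite -[X in _ <= X]e leq_addr.
Qed.

Lemma card_rows la r : sumn la = n ->
  #|[set i : 'I_n | reshape_index la i < r]| = sumn (take r la).
Proof.
move=> la_n; have le : sumn (take r la) <= n.
  by rewrite -la_n -{2}(cat_take_drop r la) sumn_cat leq_addr.
have winj : injective (widen_ord le).
  by move=> i j /(congr1 val) /= /val_inj.
rewrite -[RHS]card_ord -(card_imset _ winj).
apply: eq_card => i; rewrite !inE reshape_index_lt ?la_n //.
apply/idP/imsetP => [lti|[j _ ->]]; last by rewrite /= ltn_ord.
by exists (Ordinal lti) => //; apply: val_inj.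
Qed.

Lemma card_by_offset la (P : pred 'I_n) :
  #|[set i | P i]| =
  \sum_(c < n) #|[set i : 'I_n | P i & reshape_offset la i == c]|.
Proof.
pose f (i : 'I_n) : 'I_n :=
  Ordinal (leq_ltn_trans (reshape_offset_le la i) (ltn_ord i)).
rewrite -sum1_card (partition_big f xpredT) //=; apply: eq_bigr => c _.
by rewrite -sum1_card; apply: eq_bigl => i; rewrite !inE.
Qed.

Lemma box_inj la (i j : nat) : reshape_index la i = reshape_index la j ->
  reshape_offset la i = reshape_offset la j -> i = j.
Proof.
by move=> e1 e2; rewrite -(reshape_indexK la i) -(reshape_indexK la j) e1 e2.
Qed.


(* The first [r] rows of [mu] meet each column of [la] in at most [r] boxes. *)
Lemma dominance_of_transversal la mu (g : 'S_n) :
  sumn la = n -> sumn mu = n -> sorted geq la ->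
  (forall i j : 'I_n, reshape_index mu (g i) = reshape_index mu (g j) ->
     reshape_offset la i = reshape_offset la j -> i = j) ->
  forall r, sumn (take r mu) <= sumn (take r la).
Proof.
move=> la_n mu_n la_s inj r; rewrite -(card_rows r la_n) -(card_rows r mu_n).
have -> : #|[set i : 'I_n | reshape_index mu i < r]| =
          #|[set i : 'I_n | reshape_index mu (g i) < r]|.
  rewrite -(card_preimset _ (@perm_inj _ g)).
  by apply: eq_card => i; rewrite !inE.
rewrite (card_by_offset la) [leqRHS](card_by_offset la).
apply: leq_sum => c _.
(* If some row [k < r] does not reach column [c], then the column lies entirely above row [k]
   because rows decrease, so the right-hand set is the whole column. *)
have [all_gt|] := boolP [forall k : 'I_r, c < nth 0 la k]; last first.
  rewrite negb_forall => /existsP[k]; rewrite -leqNgt => lak.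
  apply: subset_leq_card; apply/subsetP => i; rewrite !inE => /andP[_ ic].
  rewrite ic andbT; apply: leq_ltn_trans (ltn_ord k).
  rewrite leqNgt; apply/negP => ltk.
  have lti : i < sumn la by rewrite la_n.
  have := reshape_offsetP lti; rewrite (eqP ic) ltnNge => /negP[].
  apply: leq_trans lak; apply: (sorted_leq_nth _ _ _ la_s) => //.
  - by move=> x y z; rewrite /geq /= => h1 h2; apply: leq_trans h2 h1.
  - by move=> x; rewrite /geq /=.
  - by rewrite inE (leq_trans ltk) // ltnW // reshape_indexP.
  - by rewrite inE reshape_indexP.
  - exact: ltnW.
(* Column [c] now meets each of the first [r] rows of [la]: [inj] allows at most [r] boxes on the
   left, and one box per row gives at least [r] on the right. *)
apply: (@leq_trans r).
  have [r0|r0] := posnP r.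
    by rewrite r0; apply: eq_leq; apply: eq_card0 => i; rewrite !inE.
  case: r r0 all_gt => // r _ _.
  pose F (i : 'I_n) : 'I_r.+1 := inord (reshape_index mu (g i)).
  rewrite -[X in _ <= X]card_ord -(@card_in_imset _ _ F) ?max_card //.
  move=> i j; rewrite !inE => /andP[ir ic] /andP[jr jc] /(congr1 val) /=.
  by rewrite !inordK // => e; apply: inj => //; rewrite (eqP ic) (eqP jc).
have lt (k : 'I_r) : flatten_index la k c < n.
  by rewrite -[X in _ < X]la_n; apply: flatten_indexP; exact: (forallP all_gt k).
rewrite -[X in X <= _]card_ord.
have G_inj : injective (fun k : 'I_r => Ordinal (lt k)).
  move=> k l /(congr1 val) /= /(congr1 (reshape_index la)).
  rewrite !flatten_indexKl; last 2 first.
  - exact: (forallP all_gt l).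
  - exact: (forallP all_gt k).
  exact: val_inj.
rewrite -(card_imset _ G_inj); apply: subset_leq_card.
apply/subsetP => i /imsetP[k _ ->]; rewrite !inE /=.
by rewrite flatten_indexKl ?flatten_indexKr ?(forallP all_gt) // ltn_ord eqxx.
Qed.

(** Differences of partial sums recover the parts, up to trailing zeros; the absence of zero parts
    then fixes the lengths. *)
Lemma dominance_anti la mu : 0 \notin la -> 0 \notin mu ->
  (forall r, sumn (take r mu) = sumn (take r la)) -> mu = la.
Proof.
move=> la0 mu0 e; have nthE r : nth 0 mu r = nth 0 la r.
  by apply/eqP; rewrite -(eqn_add2l (sumn (take r mu))) {2}e -!sumn_take_S e.
have lt u v : 0 \notin u -> (forall r, nth 0 u r = nth 0 v r) -> size u <= size v.
  move=> u0 uv; rewrite leqNgt; apply/negP => lt; case/negP: u0.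
  by rewrite -(nth_default 0 (leqnn (size v))) -uv mem_nth.
apply: (@eq_from_nth _ 0) => //.
by apply/eqP; rewrite eqn_leq !lt.
Qed.

End Dominance.

Local Open Scope ring_scope.
Local Open Scope complex_scope.

(** * Young symmetrisers acting on tensor powers *)

Section Dot.
Variables (R : realType) (I : finType).
Local Notation C := (R[i]).
Implicit Types T U : cspace R I.

Definition dot T U : C := \sum_x T x * conjc (U x).

Lemma dotDl T T' U : dot (T + T') U = dot T U + dot T' U.
Proof. by rewrite -big_split; apply: eq_bigr => x _; rewrite ffunE mulrDl. Qed.

Lemma dotDr T U U' : dot T (U + U') = dot T U + dot T U'.
Proof. by rewrite -big_split; apply: eq_bigr => x _; rewrite ffunE rmorphD mulrDr. Qed.

Lemma dotZl c T U : dot (c *: T) U = c * dot T U.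
Proof. by rewrite mulr_sumr; apply: eq_bigr => x _; rewrite ffunE mulrA. Qed.

Lemma dotZr c T U : dot T (c *: U) = conjc c * dot T U.
Proof.
rewrite mulr_sumr; apply: eq_bigr => x _; rewrite ffunE.
by rewrite [_ *: _]/(_ * _) rmorphM mulrCA.
Qed.

Lemma dot0l U : dot 0 U = 0.
Proof. by apply: big1 => x _; rewrite ffunE mul0r. Qed.

Lemma dot0r T : dot T 0 = 0.
Proof. by apply: big1 => x _; rewrite ffunE conjc0 mulr0. Qed.

Lemma dotBl T T' U : dot (T - T') U = dot T U - dot T' U.
Proof. by rewrite dotDl -scaleN1r dotZl mulN1r. Qed.

Lemma dotBr T U U' : dot T (U - U') = dot T U - dot T U'.
Proof. by rewrite dotDr -scaleN1r dotZr rmorphN rmorph1 mulN1r. Qed.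

Lemma dot_suml (J : Type) (r : seq J) (P : pred J) F U :
  dot (\sum_(j <- r | P j) F j) U = \sum_(j <- r | P j) dot (F j) U.
Proof. exact: (big_morph (fun T => dot T U) (fun T T' => dotDl T T' U) (dot0l U)). Qed.

Lemma dot_sumr (J : Type) (r : seq J) (P : pred J) F T :
  dot T (\sum_(j <- r | P j) F j) = \sum_(j <- r | P j) dot T (F j).
Proof. exact: (big_morph (dot T) (dotDr T) (dot0r T)). Qed.

Lemma dot_ge0 T : 0 <= dot T T.
Proof. by apply: sumr_ge0 => x _; exact: mulcJ_ge0. Qed.

Lemma dot_eq0 T : (dot T T == 0) = (T == 0).
Proof.
apply/idP/eqP => [|->]; last by rewrite dot0l.
rewrite psumr_eq0 => [/allP e|x _]; last exact: mulcJ_ge0.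
apply/ffunP => x; rewrite ffunE; apply/eqP.
by have := e x (mem_index_enum x); rewrite mulf_eq0 conjc_eq0 orbb.
Qed.

End Dot.

Section Operators.
Variables (R : realType) (n : nat).
Local Notation C := (R[i]).

Definition galgact (X : finType) (a : galg R n) (T : tpow R X n) : tpow R X n :=
  \sum_p (a p : C) *: sact p T.

Section Fixed.
Variable X : finType.
Local Notation W := (tpow R X n).
Implicit Types (T U : W) (la mu : seq nat).

Fact galgact_linear a : linear (@galgact X a).
Proof.
move=> c T U; rewrite /galgact scaler_sumr -big_split; apply: eq_bigr => p _ /=.
by rewrite linearP scalerDr !scalerA mulrC.
Qed.
HB.instance Definition _ a :=
  GRing.isLinear.Build C W W _ (@galgact X a) (galgact_linear a).

Definition rowsym la T : W := \sum_(p | row_stab la p) sact p T.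
Definition colasym la T : W :=
  \sum_(q | col_stab la q) ((-1) ^+ (odd_perm q) : C) *: sact q T.
Definition ysym la T : W := rowsym la (colasym la T).

Fact rowsym_linear la : linear (rowsym la).
Proof.
move=> c T U; rewrite /rowsym scaler_sumr -big_split; apply: eq_bigr => p _ /=.
by rewrite linearP.
Qed.
HB.instance Definition _ la :=
  GRing.isLinear.Build C W W _ (rowsym la) (rowsym_linear la).

Fact colasym_linear la : linear (colasym la).
Proof.
move=> c T U; rewrite /colasym scaler_sumr -big_split; apply: eq_bigr => p _ /=.
by rewrite linearP scalerDr !scalerA mulrC.
Qed.
HB.instance Definition _ la :=
  GRing.isLinear.Build C W W _ (colasym la) (colasym_linear la).

Fact ysym_linear la : linear (ysym la).
Proof. by move=> c T U; rewrite /ysym !linearP. Qed.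
HB.instance Definition _ la :=
  GRing.isLinear.Build C W W _ (ysym la) (ysym_linear la).

Lemma row_stabM la p q : row_stab (n:=n) la q -> row_stab la (p * q)%g = row_stab la p.
Proof.
move=> /forallP hq; apply: eq_forallb => i.
by rewrite permM (eqP (hq _)).
Qed.

Lemma col_stabM la p q : col_stab (n:=n) la p -> col_stab la (p * q)%g = col_stab la q.
Proof.
move=> /forallP hp; apply/forallP/forallP => h i.
  have := h ((p^-1)%g i); rewrite permM permKV => /eqP ->.
  by rewrite -(eqP (hp _)) permKV.
by rewrite permM (eqP (h _)) hp.
Qed.

Lemma row_stabV la p : row_stab (n:=n) la p^-1%g = row_stab la p.
Proof.
apply/forallP/forallP => h i; first by have := h (p i); rewrite permK eq_sym.
by have := h ((p^-1)%g i); rewrite permKV eq_sym.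
Qed.

Lemma col_stabV la p : col_stab (n:=n) la p^-1%g = col_stab la p.
Proof.
apply/forallP/forallP => h i; first by have := h (p i); rewrite permK eq_sym.
by have := h ((p^-1)%g i); rewrite permKV eq_sym.
Qed.

Lemma sact_rowsym la p T : row_stab la p -> sact p (rowsym la T) = rowsym la T.
Proof.
move=> hp; rewrite /rowsym linear_sum /= [RHS](reindex_inj (mulIg p)) /=.
apply: eq_big => [q|q _]; first by rewrite row_stabM.
by rewrite sactM.
Qed.

Lemma sact_colasym la (i j : 'I_n) T : i != j ->
  reshape_offset la i = reshape_offset la j ->
  sact (tperm i j) (colasym la T) = - colasym la T.
Proof.
move=> ij e; rewrite /colasym linear_sum /= -sumrN.
rewrite [RHS](reindex_inj (mulIg (tperm i j))) /=.
apply: eq_big => [q|q _]; last first.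
  rewrite linearZ /= sactM odd_permM odd_tperm ij signr_addb expr1 mulrN1.
  by rewrite scaleNr opprK.
apply: eq_forallb => k; rewrite permM; congr (_ == _).
by case: tpermP => [->|->|].
Qed.

Lemma colasym_sact la (i j : 'I_n) T : i != j ->
  reshape_offset la i = reshape_offset la j ->
  colasym la (sact (tperm i j) T) = - colasym la T.
Proof.
move=> ij e; rewrite /colasym -sumrN.
rewrite [RHS](reindex_inj (mulgI (tperm i j))) /=.
apply: eq_big => [q|q _]; last first.
  rewrite sactM odd_permM odd_tperm ij signr_addb expr1 mulN1r.
  by rewrite scaleNr opprK.
rewrite col_stabM //; apply/forallP => k.
by case: tpermP => [->|->|] //; rewrite e.
Qed.

(** The transposition of [i] and [j] fixes the row-symmetrised tensor moved by [h], but changes the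
    sign of [colasym la], so the result equals its own negative. *)
Lemma colasym_rowsym0 la mu (h : 'S_n) (i j : 'I_n) T : i != j ->
  reshape_offset la i = reshape_offset la j ->
  reshape_index mu ((h^-1)%g i) = reshape_index mu ((h^-1)%g j) ->
  colasym la (sact h (rowsym mu T)) = 0.
Proof.
move=> ij e1 e2; set U := sact h _.
have sU : sact (tperm i j) U = U.
  rewrite /U sactM.
  have -> : (h * tperm i j = tperm (h^-1 i) (h^-1 j) * h)%g.
    by rewrite -tpermJ /conjg invgK !mulgA mulgKV.
  rewrite -sactM sact_rowsym //; apply/forallP => k.
  by case: tpermP => [->|->|] //; rewrite e2.
have := colasym_sact U ij e1; rewrite sU => /eqP.
by rewrite -addr_eq0 -mulr2n -scaler_nat scaler_eq0 pnatr_eq0 => /eqP.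
Qed.

(** If the value were nonzero, no two positions could share a column of [la] and, after [h^-1], a
    row of [mu]; that is the hypothesis of [dominance_of_transversal]. *)
Lemma colasym_rowsym_dom la mu (h : 'S_n) T : is_part n la -> is_part n mu ->
  ~ (forall r, sumn (take r mu) <= sumn (take r la))%N ->
  colasym la (sact h (rowsym mu T)) = 0.
Proof.
move=> /and3P[las _ /eqP la_n] /and3P[_ _ /eqP mu_n] ndom.
apply: contrapT => ne0; apply: ndom.
apply: (@dominance_of_transversal n la mu (h^-1)%g) => // i j e2 e1.
apply/eqP/negPn/negP => ij; apply: ne0; exact: colasym_rowsym0 ij e1 e2.
Qed.

Definition zact la T : W := \sum_g sact g^-1 (ysym la (sact g T)).

(** Summing over all conjugates makes the Young symmetriser a class function, hence central; [zact]
    is its action. *)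
Definition ycent la : galg R n := [ffun s => \sum_g young_sym R n la (s ^ g)%g].

Lemma galgact_young la T : galgact (young_sym R n la) T = ysym la T.
Proof.
rewrite /galgact /ysym /rowsym.
under eq_bigr => s _ do (rewrite ffunE scaler_suml).
rewrite exchange_big /=; apply: eq_bigr => p _.
rewrite /colasym linear_sum /=.
under eq_bigr => s _ do rewrite scaler_suml.
rewrite exchange_big /=; apply: eq_bigr => q _.
rewrite (bigD1 (q * p)%g) //= big1 ?addr0 => [|s /negPf ->]; last first.
  by rewrite mulr0 scale0r.
by rewrite eqxx mulr1 linearZ /= sactM.
Qed.

Lemma galgact_ycent la T : galgact (ycent la) T = zact la T.
Proof.
rewrite /galgact /zact.
under eq_bigr => s _ do (rewrite ffunE scaler_suml).
rewrite exchange_big /=; apply: eq_bigr => g _.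
rewrite -galgact_young /galgact linear_sum /= (reindex_inj (conjg_inj g^-1%g)) /=.
apply: eq_bigr => s _; rewrite conjgKV linearZ /= !sactM; congr (_ *: sact _ _).
by rewrite conjgE invgK mulgA.
Qed.

End Fixed.
End Operators.

(** * The centre of the group algebra *)

Section Central.
Variables (R : realType) (n : nat).
Local Notation C := (R[i]).
Implicit Types (la mu : seq nat) (p q s g h : 'S_n).

Lemma ycent_class la s h : ycent R n la (s ^ h)%g = ycent R n la s.
Proof.
rewrite !ffunE [RHS](reindex_inj (mulgI h)) /=.
by apply: eq_bigr => g _; rewrite conjgM.
Qed.

(** Inversion turns [q * p] into a product in the opposite order, which conjugation by [p] restores;
    the stabilisers and the sign are stable under inversion. Together with [ycent_real] this makes
    [zact] self-adjoint. *)
Lemma ycentV la s : ycent R n la s^-1%g = ycent R n la s.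
Proof.
rewrite !ffunE.
transitivity (\sum_(p : 'S_n | row_stab la p) \sum_(q : 'S_n | col_stab la q)
   \sum_(g : 'S_n) ((-1) ^+ (odd_perm q) * ((s^-1) ^ g == q * p)%g%:R : C)).
  under eq_bigr => g _ do rewrite ffunE.
  rewrite exchange_big /=; apply: eq_bigr => p _.
  by rewrite exchange_big.
transitivity (\sum_(p : 'S_n | row_stab la p) \sum_(q : 'S_n | col_stab la q)
   \sum_(g : 'S_n) ((-1) ^+ (odd_perm q) * (s ^ g == q * p)%g%:R : C)); last first.
  under [RHS]eq_bigr => g _ do rewrite ffunE.
  rewrite [RHS]exchange_big /=; apply: eq_bigr => p _.
  by rewrite [RHS]exchange_big.
rewrite (reindex_inj invg_inj) /=.
apply: eq_big => [p|p _]; first exact: row_stabV.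
rewrite (reindex_inj invg_inj) /=.
apply: eq_big => [q|q _]; first exact: col_stabV.
rewrite (reindex_inj (mulIg p^-1)%g) /=; apply: eq_bigr => g _.
rewrite odd_permV; congr (_ * _%:R).
rewrite -invMg conjVg (inj_eq invg_inj) conjgM.
by rewrite -(inj_eq (conjg_inj p)) conjgKV [in X in _ == X]conjgE mulgA mulKg.
Qed.

Lemma ycent_real la s : conjc (ycent R n la s) = ycent R n la s.
Proof.
rewrite !ffunE rmorph_sum; apply: eq_bigr => g _.
rewrite ffunE rmorph_sum; apply: eq_bigr => p _.
rewrite rmorph_sum; apply: eq_bigr => q _ /=.
by rewrite rmorphM rmorphXn rmorphN rmorph1 rmorph_nat.
Qed.

Lemma row_col_stab1 la p : row_stab la p -> col_stab la p -> p = 1%g.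
Proof.
move=> /forallP hr /forallP hc; apply/permP => i; rewrite perm1.
by apply: val_inj; apply: (@box_inj la); apply/eqP; rewrite ?hr ?hc.
Qed.

Lemma stab1 la : row_stab la (1%g : 'S_n) && col_stab la (1%g : 'S_n).
Proof. by apply/andP; split; apply/forallP => i; rewrite perm1. Qed.

(** The row and column stabilisers meet only in the identity, so each of the [n!] conjugates
    contributes 1. *)
Lemma ycent1 la : ycent R n la 1%g = n`!%:R.
Proof.
rewrite ffunE (eq_bigr (fun=> 1)) ?sumr_const ?card_Sn // => g _.
rewrite conj1g ffunE; have /andP[r1 c1] := stab1 la.
rewrite (bigD1 1%g) //= (bigD1 1%g) //= mulg1 eqxx odd_perm1 mulr1.
rewrite !big1 ?addr0 // => [p /andP[rp p1]|q /andP[_ q1]]; last first.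
  by rewrite mulg1 eq_sym (negPf q1) mulr0.
apply: big1 => q cq; case: eqP => [e|]; last by rewrite mulr0.
case/negP: p1; apply/eqP; apply: (@row_col_stab1 la) => //.
by rewrite -col_stabV; have -> : p^-1%g = q by apply/eqP; rewrite eq_sym -mulg_eq1 -e.
Qed.

Section Fixed.
Variable X : finType.
Local Notation W := (tpow R X n).
Implicit Types (T U : W).

Lemma galgact_class_sact (f : galg R n) h T :
  (forall s g, f (s ^ g)%g = f s) -> galgact f (sact h T) = sact h (galgact f T).
Proof.
move=> fc; rewrite /galgact linear_sum /= [LHS](reindex_inj (conjg_inj h)) /=.
apply: eq_bigr => s _; rewrite fc linearZ /= !sactM.
by rewrite conjgE !mulgA mulgV mul1g.
Qed.

Lemma zact_sact la h T : zact la (sact h T) = sact h (zact la T).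
Proof. by rewrite -!galgact_ycent galgact_class_sact // => s g; exact: ycent_class. Qed.

Fact zact_linear la : linear (@zact R n X la).
Proof. by move=> c T U; rewrite -!galgact_ycent linearP. Qed.
HB.instance Definition _ la :=
  GRing.isLinear.Build C W W _ (@zact R n X la) (zact_linear la).

Lemma zact_ysym la mu T : zact la (ysym mu T) = ysym mu (zact la T).
Proof.
have colE : zact la (colasym mu T) = colasym mu (zact la T).
  rewrite /colasym linear_sum /=; apply: eq_bigr => q _.
  by rewrite linearZ /= zact_sact.
rewrite /ysym -colE /rowsym linear_sum /=; apply: eq_bigr => p _.
by rewrite zact_sact.
Qed.

(** Distinct partitions cannot dominate each other both ways. Whichever direction fails, centrality
    of [zact la] allows the factors to be ordered so that [colasym_rowsym_dom] applies. *)
Lemma zact_ysym0 la mu T : is_part n la -> is_part n mu -> la != mu ->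
  zact la (ysym mu T) = 0.
Proof.
move=> pla pmu ne.
have [dom|dom] := pselect (forall r, sumn (take r mu) <= sumn (take r la))%N.
  rewrite zact_ysym /zact linear_sum big1 // => g _ /=.
  rewrite /ysym colasym_rowsym_dom ?linear0 // => dom'; case/eqP: ne.
  have /and3P[_ la0 _] := pla; have /and3P[_ mu0 _] := pmu.
  by apply: dominance_anti => // r; apply/eqP; rewrite eqn_leq dom dom'.
rewrite /zact big1 // => g _; rewrite {1}/ysym colasym_rowsym_dom //.
by rewrite !linear0.
Qed.

Lemma zact_zact0 la mu T : is_part n la -> is_part n mu -> la != mu ->
  zact la (zact mu T) = 0.
Proof.
move=> pla pmu ne; rewrite [zact mu T]/zact linear_sum big1 // => g _ /=.
by rewrite zact_sact zact_ysym0 ?linear0.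
Qed.

Lemma dot_sact p T U : dot (sact p T) U = dot T (sact p^-1 U).
Proof.
rewrite /dot; pose f (x : {ffun 'I_n -> X}) : {ffun 'I_n -> X} :=
  [ffun i => x ((p^-1)%g i)].
rewrite (reindex_onto f (fun x => [ffun i => x (p i)])) => [|x _]; last first.
  by apply/ffunP => i; rewrite !ffunE permKV.
have fK (x : {ffun 'I_n -> X}) : [ffun i => f x (p i)] = x.
  by apply/ffunP => i; rewrite !ffunE permK.
by apply: eq_big => [x|x _]; rewrite ?fK ?eqxx // [sact p T _]ffunE fK ffunE.
Qed.

Lemma dot_galgact (f : galg R n) T U : (forall s, conjc (f s) = f s) ->
  (forall s, f s^-1%g = f s) -> dot (galgact f T) U = dot T (galgact f U).
Proof.
move=> fr fV; rewrite /galgact dot_suml dot_sumr [RHS](reindex_inj invg_inj) /=.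
by apply: eq_bigr => p _; rewrite dotZl dotZr dot_sact fV fr.
Qed.

Lemma dot_zact la T U : dot (zact la T) U = dot T (zact la U).
Proof.
by rewrite -!galgact_ycent dot_galgact //; [exact: ycent_real | exact: ycentV].
Qed.

End Fixed.

Definition pword s : {ffun 'I_n -> 'I_n} := [ffun i => s i].

(** The word with all letters distinct generates a copy of the regular representation, so identities
    in the group algebra can be tested on this single vector. *)
Definition idword : tpow R 'I_n n := [ffun x => (x == pword 1%g)%:R : C].

Lemma galgact_idword (a : galg R n) s : galgact a idword (pword s) = a s^-1%g.
Proof.
rewrite /galgact sum_ffunE (bigD1 s^-1%g) //= big1 => [|p ps].
  rewrite addr0 !ffunE (_ : _ == _) ?[_ *: _]mulr1 //.
  by apply/eqP/ffunP => i; rewrite !ffunE permKV perm1.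
rewrite !ffunE (_ : _ == _ = false) ?[_ *: _]mulr0 //.
apply: contra_neqF ps => /eqP/ffunP e; rewrite -[p](mulgK s).
have -> : (p * s)%g = 1%g by apply/permP => i; have := e i; rewrite !ffunE permM.
by rewrite mul1g.
Qed.

Lemma galgact_faithful (a b : galg R n) :
  galgact a idword = galgact b idword -> a = b.
Proof.
by move=> e; apply/ffunP => s; rewrite -[s]invgK -!galgact_idword e.
Qed.

Lemma galgactZ X c (a : galg R n) (T : tpow R X n) :
  galgact (c *: a) T = c *: galgact a T.
Proof.
by rewrite /galgact scaler_sumr; apply: eq_bigr => p _; rewrite ffunE -scalerA.
Qed.

Lemma galgactD X (a b : galg R n) (T : tpow R X n) :
  galgact (a + b) T = galgact a T + galgact b T.
Proof. by rewrite -big_split; apply: eq_bigr => p _; rewrite ffunE scalerDl. Qed.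

Lemma galgact0 X (T : tpow R X n) : galgact 0 T = 0.
Proof. by apply: big1 => p _; rewrite ffunE scale0r. Qed.

Lemma galgact_sum X (J : Type) (r : seq J) F (T : tpow R X n) :
  galgact (\sum_(j <- r) F j) T = \sum_(j <- r) galgact (F j) T.
Proof.
exact: (big_morph (fun a => galgact a T) (fun a b => galgactD a b T) (galgact0 T)).
Qed.

(** By self-adjointness, a vanishing square would force [zact la idword] itself to vanish, but its
    value at the identity word is [n!]. *)
Lemma zact_idword_neq0 la : zact la (zact la idword) != 0.
Proof.
apply/eqP => e; have : dot (zact la idword) (zact la idword) == 0.
  by rewrite dot_zact e dot0r.
rewrite dot_eq0 => /eqP/ffunP/(_ (pword 1%g)).
rewrite -galgact_ycent galgact_idword invg1 ycent1 ffunE => /eqP.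
by apply/negP; exact: nfact0.
Qed.

(** Applying [zact mu] to the relation, evaluated on [idword], kills every term except that of
    [mu]. *)
Lemma ycent_free (L : seq (seq nat)) (c : seq nat -> C) :
  uniq L -> (forall la, la \in L -> is_part n la) ->
  \sum_(la <- L) c la *: ycent R n la = 0 -> forall la, la \in L -> c la = 0.
Proof.
move=> uL pL e mu muL; have := congr1 (fun a => zact mu (galgact a idword)) e.
rewrite galgact_sum galgact0 !linear_sum linear0 /= (bigD1_seq mu) //=.
rewrite big1_seq => [|la /andP[ne laL]]; last first.
  by rewrite galgactZ galgact_ycent linearZ /= zact_zact0 ?scaler0 ?pL // eq_sym.
rewrite addr0 galgactZ galgact_ycent linearZ /= => /eqP.
by rewrite scaler_eq0 (negPf (zact_idword_neq0 mu)) orbF => /eqP.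
Qed.

Definition cycle_types : seq (seq nat) := undup [seq cycle_type p | p : 'S_n].

Lemma cycle_types_part la : la \in cycle_types -> is_part n la.
Proof. by rewrite mem_undup => /mapP[p _ ->]; exact: cycle_type_is_part. Qed.

Definition gone : galg R n := [ffun s => (s == 1%g)%:R : C].

Lemma galgact_gone X (T : tpow R X n) : galgact gone T = T.
Proof.
rewrite /galgact (bigD1 1%g) //= big1 => [|s /negPf s1]; last first.
  by rewrite ffunE s1 scale0r.
by rewrite ffunE eqxx scale1r addr0 sact1.
Qed.

(* There are as many elements [ycent la] as conjugacy classes, so these
   independent class functions span the identity. *)
Lemma ycent_span : exists c : seq nat -> C,
  gone = \sum_(la <- cycle_types) c la *: ycent R n la.
Proof.
pose k := size cycle_types; pose L (i : 'I_k) := nth [::] cycle_types i.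
have repP i : exists p : 'S_n, cycle_type p = L i.
  have : L i \in cycle_types by exact: mem_nth.
  by rewrite mem_undup => /mapP[p _ ->]; exists p.
pose rep i := projT1 (cid (repP i)).
have repE i : cycle_type (rep i) = L i by rewrite /rep; case: cid.
have cover (f f' : 'S_n -> C) : (forall s h, f (s ^ h)%g = f s) ->
    (forall s h, f' (s ^ h)%g = f' s) ->
    (forall i, f (rep i) = f' (rep i)) -> forall s, f s = f' s.
  move=> fc fc' e s.
  have ls : cycle_type s \in cycle_types by rewrite mem_undup map_f // mem_enum.
  have lti : (index (cycle_type s) cycle_types < k)%N by rewrite index_mem.
  have [g ->] : exists g, s = (rep (Ordinal lti) ^ g)%g.
    by apply: cycle_type_conj; rewrite repE /L /= nth_index.
  by rewrite fc fc'.
have zc (v : 'I_k -> C) s h :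
    (\sum_i v i *: ycent R n (L i)) (s ^ h)%g = (\sum_i v i *: ycent R n (L i)) s.
  by rewrite !sum_ffunE; apply: eq_bigr => i _; rewrite [LHS]ffunE [RHS]ffunE ycent_class.
have idxE (v : seq nat -> C) :
    \sum_(la <- cycle_types) v la *: ycent R n la = \sum_i v (L i) *: ycent R n (L i).
  by rewrite (big_nth [::]) big_mkord.
have uL : uniq cycle_types by exact: undup_uniq.
pose M := \matrix_(i < k, j < k) (ycent R n (L i) (rep j) : C).
(* A row vector read as a family indexed by partitions; the value 0 off the list is never summed. *)
pose D (v : 'rV[C]_k) (la : seq nat) : C :=
  if insub (index la cycle_types) is Some i then v 0 i else 0.
have DL v i : D v (L i) = v 0 i.
  by rewrite /D /L index_uniq // valK.
(* A row relation says that a combination of the [ycent] vanishes at the class representatives,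
   hence everywhere, contradicting their independence unless it is trivial. *)
have uM : M \in unitmx.
  rewrite -row_free_unit -kermx_eq0; apply/rowV0P => v /sub_kermxP vM.
  have z0 : \sum_(la <- cycle_types) D v la *: ycent R n la = 0.
    rewrite idxE; apply/ffunP; apply: cover => [s h|s h|j].
    - exact: (zc (fun i => D v (L i))).
    - by rewrite !ffunE.
    rewrite [RHS]ffunE.
    have := congr1 (fun w : 'rV_k => w 0 j) vM; rewrite !mxE => <-.
    by rewrite sum_ffunE; apply: eq_bigr => i _; rewrite ffunE DL mxE.
  apply/rowP => i; rewrite mxE -DL.
  by apply: (ycent_free uL cycle_types_part z0); exact: mem_nth.
pose v := \row_j (gone (rep j) : C) *m invmx M.
exists (D v); rewrite idxE; apply/ffunP; apply: cover => [s h|s h|j].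
- by rewrite !ffunE conjg_eq1.
- exact: (zc (fun i => D v (L i))).
have : (v *m M) 0 j = gone (rep j) by rewrite mulmxKV // mxE.
rewrite mxE => <-; rewrite sum_ffunE; apply: eq_bigr => i _.
by rewrite ffunE DL [M i j]mxE.
Qed.

End Central.

(** * Isotypic projections *)

Section Projections.
Variables (R : realType) (n : nat).
Local Notation C := (R[i]).
Implicit Types (la mu : seq nat) (p q s g h : 'S_n).

Definition ecoef : seq nat -> C := projT1 (cid (ycent_span R n)).

Lemma ecoef_span :
  gone R n = \sum_(la <- cycle_types n) ecoef la *: ycent R n la.
Proof. by rewrite /ecoef; case: cid. Qed.

(** Conjugation yields another expansion of the identity in the real elements [ycent], and
    expansions are unique. *)
Lemma ecoef_real la : la \in cycle_types n -> conjc (ecoef la) = ecoef la.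
Proof.
move=> laL; apply/eqP; rewrite -subr_eq0; apply/eqP; move: la laL.
apply: (@ycent_free R n _ (fun la => conjc (ecoef la) - ecoef la) (undup_uniq _)).
  exact: cycle_types_part.
under eq_bigr => la _ do rewrite scalerBl.
rewrite sumrB -ecoef_span; apply/eqP; rewrite subr_eq0; apply/eqP/ffunP => s.
have -> : gone R n s = conjc (gone R n s) by rewrite ffunE conjc_nat.
rewrite ecoef_span !sum_ffunE rmorph_sum; apply: eq_bigr => la _ /=.
by rewrite [LHS]ffunE [in RHS]ffunE [in RHS]/GRing.scale /= rmorphM /= ycent_real.
Qed.

Definition ecent la : galg R n := ecoef la *: ycent R n la.

Section Fixed.
Variable X : finType.
Local Notation W := (tpow R X n).
Implicit Types (T U : W).

Definition pact la T : W := galgact (ecent la) T.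

Lemma pactE la T : pact la T = ecoef la *: zact la T.
Proof. by rewrite /pact galgactZ galgact_ycent. Qed.

Fact pact_linear la : linear (pact la).
Proof. by move=> c T U; rewrite /pact linearP. Qed.
HB.instance Definition _ la :=
  GRing.isLinear.Build C W W _ (pact la) (pact_linear la).

Lemma pact_sum T : \sum_(la <- cycle_types n) pact la T = T.
Proof. by rewrite -galgact_sum -ecoef_span galgact_gone. Qed.

Lemma pact_ortho la mu T : la \in cycle_types n -> mu \in cycle_types n ->
  la != mu -> pact la (pact mu T) = 0.
Proof.
move=> laL muL ne; rewrite !pactE linearZ /= zact_zact0 ?scaler0 //;
  exact: cycle_types_part.
Qed.

(** Decompose [pact la T] by [pact_sum]: orthogonality leaves only the term of [la]. *)
Lemma pact_idem la T : la \in cycle_types n -> pact la (pact la T) = pact la T.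
Proof.
move=> laL; rewrite -[RHS]pact_sum (bigD1_seq la) ?undup_uniq //= big1_seq ?addr0 //.
by move=> mu /andP[ne muL]; exact: pact_ortho.
Qed.

Lemma pact_sact la h T : pact la (sact h T) = sact h (pact la T).
Proof. by rewrite !pactE zact_sact linearZ. Qed.

Lemma dot_pact la T U : la \in cycle_types n ->
  dot (pact la T) U = dot T (pact la U).
Proof. by move=> laL; rewrite !pactE dotZl dotZr ecoef_real // dot_zact. Qed.

Lemma galgact_glact a (g : 'M[C]_#|X|) T : galgact a (glact g T) = glact g (galgact a T).
Proof.
rewrite /galgact linear_sum; apply: eq_bigr => p _.
by rewrite linearZ /= glact_sact.
Qed.

Lemma galgact_act p a T : galgact (galg_act p a) T = sact p (galgact a T).
Proof.
rewrite /galgact linear_sum (reindex_inj (mulIg p)) /=; apply: eq_bigr => s _.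
by rewrite ffunE mulgK linearZ /= sactM.
Qed.

Lemma galgact_mul a b T : galgact (galg_mul a b) T = galgact a (galgact b T).
Proof.
rewrite /galgact.
under eq_bigr => s _ do (rewrite ffunE scaler_suml).
rewrite exchange_big /=; apply: eq_bigr => p _.
rewrite linear_sum scaler_sumr (reindex_inj (mulIg p)) /=.
apply: eq_bigr => s _.
by rewrite mulgK linearZ /= sactM scalerA.
Qed.

Lemma zact_gaact la a T : zact la (galgact a T) = galgact a (zact la T).
Proof.
rewrite /galgact linear_sum; apply: eq_bigr => p _.
by rewrite linearZ /= zact_sact.
Qed.

End Fixed.

(** Tested on [idword], the central action of [ycent la] moves past the left factor and meets the
    Young symmetriser of [mu], which it annihilates. *)
Lemma ycent_specht0 la mu (a : galg R n) :
  is_part n la -> is_part n mu -> la != mu -> specht mu a ->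
  \sum_p ycent R n la p *: galg_act p a = 0.
Proof.
move=> pla pmu ne [b ->]; apply: galgact_faithful; rewrite galgact_sum galgact0.
under eq_bigr => p _ do rewrite galgactZ galgact_act.
rewrite -/(galgact (ycent R n la) _) galgact_ycent galgact_mul zact_gaact galgact_young.
by rewrite zact_ysym0 // linear0.
Qed.

(** A morphism from the Specht module carries along the action of each [ycent mu], which is zero
    there for [mu != la]; only the term of [la] in [pact_sum] survives. *)
Lemma pact_isotypic X la (T : tpow R X n) : la \in cycle_types n ->
  isotypic la T -> pact la T = T.
Proof.
move=> laL [m [f [a [fa ->]]]]; rewrite linear_sum; apply: eq_bigr => i _ /=.
have [fi ai] := fa i; rewrite -[RHS]pact_sum (bigD1_seq la) ?undup_uniq //=.
rewrite big1_seq ?addr0 // => mu /andP[ne muL].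
rewrite pactE -galgact_ycent /galgact.
under eq_bigr => p _ do rewrite -fi // -linearZ.
by rewrite -linear_sum (@ycent_specht0 mu la) ?linear0 ?scaler0 // cycle_types_part.
Qed.

(** Each summand of [zact] is the image of a translated Young symmetriser under the morphism sending
    [a] to [galgact a (sact g T)]. *)
Lemma isotypic_pact X la (T : tpow R X n) : isotypic la (pact la T).
Proof.
rewrite pactE; apply: isotypicZ; rewrite /zact.
apply: (big_ind (@isotypic R n X la)); first exact: isotypic0.
  by move=> U V; exact: isotypicD.
move=> g _.
pose fg (a : galg R n) := galgact a (sact g T).
have fgL : linear fg by move=> c a b; rewrite /fg galgactD galgactZ.
pose F := HB.pack_for {linear galg R n -> tpow R X n} fg
  (GRing.isLinear.Build C _ _ _ fg fgL).
exists 1%N, (fun=> linfun F), (fun=> galg_act g^-1%g (young_sym R n la)); split.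
  move=> _; split; first by move=> p a _; rewrite !lfunE /= /fg galgact_act.
  exists [ffun s => (s == g^-1%g)%:R : C]; apply/ffunP => s.
  rewrite [LHS]ffunE [RHS]ffunE.
  rewrite (bigD1 g^-1%g) //= big1 => [|p /negPf p1]; last by rewrite ffunE p1 mul0r.
  by rewrite [X in X * _]ffunE eqxx mul1r addr0.
by rewrite big_ord1 lfunE /= /fg galgact_act galgact_young.
Qed.

Lemma isoprojE X la : la \in cycle_types n ->
  isoproj R n X la = linfun (@pact X la).
Proof.
move=> laL; apply: isoproj_uniq (isoprojP _ _ _ _) _; split.
- by move=> p T; rewrite !lfunE /= pact_sact.
- by move=> g T _; rewrite !lfunE /= /pact galgact_glact.
- by apply/lfunP => T; rewrite comp_lfunE !lfunE /= pact_idem.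
move=> T; split=> [/memv_imgP[U _ ->]|iT].
  rewrite lfunE; exact: isotypic_pact.
by rewrite -(pact_isotypic laL iT) -[pact _ _]lfunE memv_img ?memvf.
Qed.

End Projections.

(** * Dimension of the isotypic components *)

(** In the full-rank factorisation of an idempotent, the product of the factors in the other order
    is the identity of size the rank; the trace does not see the order. *)
Lemma mxtrace_idem (F : fieldType) m (M : 'M[F]_m) :
  M *m M = M -> \tr M = (\rank M)%:R.
Proof.
move=> MM; have e : row_base M *m col_base M = 1%:M.
  apply: (row_free_inj (row_base_free M)); rewrite mul1mx.
  have lfree : row_free (col_base M)^T.
    by rewrite -row_leq_rank mxrank_tr (eqP (col_base_full M)).
  apply: trmx_inj; apply: (row_free_inj lfree).
  rewrite -!trmx_mul -(mulmxA (row_base M)) mulmx_base.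
  by rewrite (mulmxA (col_base M)) mulmx_base MM.
by rewrite -{1}(mulmx_base M) mxtrace_mulC e mxtrace1.
Qed.

(** * Joint types of pairs of words *)

Section JointType.
Variables (n : nat) (A X : finType).

(** The counts are at most [n], so [inord] loses nothing, and the number of joint types is
    polynomial in [n] for fixed alphabets. *)
Definition joint_type (f : {ffun 'I_n -> A}) (x : {ffun 'I_n -> X}) :
    {ffun A * X -> 'I_n.+1} :=
  [ffun kl => inord #|[set i | (f i, x i) == kl]|].

Lemma joint_type_perm f x x' : joint_type f x = joint_type f x' ->
  exists p : 'S_n, (forall i, f (p i) = f i) /\ (forall i, x (p i) = x' i).
Proof.
move=> /ffunP e.
have e2 kl : #|[set i | (f i, x i) == kl]| = #|[set i | (f i, x' i) == kl]|.
  have := congr1 val (e kl); rewrite !ffunE /= !inordK // ltnS;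
    by rewrite -[leqRHS]card_ord max_card.
have /tuple_permP[p ep] : perm_eq [tuple (f i, x' i) | i < n]
                                [tuple (f i, x i) | i < n].
  have cnt (g : 'I_n -> A * X) kl :
      count_mem kl [tuple g i | i < n] = #|[set i | g i == kl]|.
    rewrite -sum1_count big_tuple -sum1_card.
    by apply: eq_bigl => i; rewrite tnth_mktuple inE.
  by apply/allP => kl _; rewrite /= !cnt e2.
exists p.
have E i : (f i, x' i) = (f (p i), x (p i)).
  have := congr1 (fun s => nth (f i, x i) s i) ep.
  by rewrite !nth_mktuple tnth_mktuple.
by split=> i; case: (E i).
Qed.

End JointType.

Lemma card_row n la (k : nat) : sumn la = n ->
  #|[set i : 'I_n | reshape_index la i == k]| = nth 0%N la k.
Proof.
move=> la_n; apply/eqP; rewrite -(eqn_add2l (sumn (take k la))) -sumn_take_S.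
rewrite -!(card_rows _ la_n) -cardsUI.
rewrite (_ : _ :&: _ = finset.set0)%SET ?cards0 ?addn0; last first.
  by apply/setP => i; rewrite !inE; case: ltngtP.
by apply/eqP/eq_card => i; rewrite !inE ltnS [RHS]leq_eqVlt orbC.
Qed.

Section TraceBound.
Variables (R : realType) (n : nat) (X : finType).
Local Notation C := (R[i]).
Local Notation W := (tpow R X n).
Implicit Types (la : seq nat) (x y : {ffun 'I_n -> X}).

Definition word_vec y : W := [ffun x => (x == y)%:R : C].

Lemma word_vecE (T : W) : T = \sum_y (T y : C) *: word_vec y.
Proof.
apply/ffunP => x; rewrite sum_ffunE (bigD1 x) //= big1 => [|y /negPf yx].
  by rewrite addr0 !ffunE eqxx [_ *: _]mulr1.
by rewrite !ffunE eq_sym yx [_ *: _]mulr0.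
Qed.

Lemma dot_word_vec (T : W) y : dot T (word_vec y) = T y.
Proof.
rewrite /dot (bigD1 y) //= big1 => [|x /negPf yx]; last first.
  by rewrite ffunE yx conjc0 mulr0.
by rewrite ffunE eqxx conjc1 mulr1 addr0.
Qed.

Definition pdiag la x : C := pact la (word_vec x) x.

Lemma pdiagE la x : la \in cycle_types n ->
  pdiag la x = dot (pact la (word_vec x)) (pact la (word_vec x)).
Proof. by move=> laL; rewrite dot_pact // pact_idem // -dot_pact // dot_word_vec. Qed.

Lemma pdiag_ge0 la x : la \in cycle_types n -> 0 <= pdiag la x.
Proof. by move=> laL; rewrite pdiagE // dot_ge0. Qed.

(** The squared norm of a basis vector minus its projection is [1 - pdiag la x]. *)
Lemma pdiag_le1 la x : la \in cycle_types n -> pdiag la x <= 1.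
Proof.
move=> laL; have := dot_ge0 (word_vec x - pact la (word_vec x)).
rewrite dotBl !dotBr -pdiagE // dot_pact // !dot_word_vec -dot_pact // dot_word_vec.
by rewrite [word_vec x x]ffunE eqxx -/(pdiag la x) subrr subr0 subr_ge0.
Qed.

Definition has_content la (f : {ffun 'I_n -> 'I_(size la)}) : bool :=
  [forall k, #|[set i | f i == k]| == nth 0%N la k].
Arguments has_content : clear implicits.

Lemma row_word_subproof la (g : 'S_n) (i : 'I_n) :
  sumn la = n -> (reshape_index la (g i) < size la)%N.
Proof. by move=> e; apply: reshape_indexP; rewrite e. Qed.

(** The tabloid of [g]: position [i] is labelled by the row containing the box [g i]. *)
Definition row_word la (e : sumn la = n) (g : 'S_n) : {ffun 'I_n -> 'I_(size la)} :=
  [ffun i => Ordinal (row_word_subproof g i e)].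

Lemma row_word_content la (e : sumn la = n) g : has_content la (row_word e g).
Proof.
apply/forallP => k; rewrite -(card_row k e).
rewrite -[X in _ == X](card_preimset _ (@perm_inj _ g)); apply/eqP/eq_card => i.
by rewrite !inE ffunE -val_eqE.
Qed.

(* [sact g^-1 (ysym la U)] is invariant under the permutations preserving
   [row_word e g], so its value at a word only depends on a joint type. *)
Lemma sact_ysym_joint la (e : sumn la = n) g (U : W) x x' :
  joint_type (row_word e g) x = joint_type (row_word e g) x' ->
  sact g^-1 (ysym la U) x = sact g^-1 (ysym la U) x'.
Proof.
move=> /joint_type_perm[p [fp xp]].
have -> : x' = [ffun i => x (p i)] by apply/ffunP => i; rewrite ffunE xp.
suff V_inv : sact p (sact g^-1 (ysym la U)) = sact g^-1 (ysym la U).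
  by rewrite -[in LHS]V_inv ffunE.
rewrite sactM.
have -> : (g^-1 * p = (g^-1 * p * g) * g^-1)%g by rewrite mulgK.
rewrite -sactM.
congr (sact _ _); apply: sact_rowsym; apply/forallP => i; rewrite !permM.
have /(congr1 val) /= := fp ((g^-1)%g i); rewrite !ffunE /= => ->.
by rewrite permKV.
Qed.

(** The sum is the trace of an idempotent matrix, hence its rank. The matrix factors through a space
    indexed by pairs of a row word of content [la] and a joint type, and the bound counts these
    pairs. *)
Lemma sum_pdiag_le la : la \in cycle_types n ->
  \sum_x pdiag la x <=
  (#|[set f | has_content la f]| * n.+1 ^ (size la * #|X|))%:R.
Proof.
move=> laL; have /and3P[_ _ /eqP e] := cycle_types_part laL.
pose Wd := {ffun 'I_n -> X}.
pose M : 'M[C]_#|Wd| := \matrix_(a, b) pact la (word_vec (enum_val b)) (enum_val a).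
have trM : \sum_x pdiag la x = \tr M.
  rewrite /mxtrace (reindex (@enum_val _ Wd)) /=; last first.
    exact/onW_bij/enum_val_bij.
  by apply: eq_bigr => a _; rewrite mxE.
have MM : M *m M = M.
  apply/matrixP => a b; rewrite !mxE.
  have := pact_idem (word_vec (enum_val b)) laL.
  rewrite [in LHS](word_vecE (pact la (word_vec (enum_val b)))).
  rewrite linear_sum /= => /ffunP/(_ (enum_val a)) <-; rewrite sum_ffunE.
  rewrite [RHS](reindex (@enum_val _ Wd)) /=; last exact/onW_bij/enum_val_bij.
  apply: eq_bigr => c _; rewrite !mxE linearZ /= ffunE.
  by rewrite mulrC.
rewrite trM mxtrace_idem // ler_nat.
pose F := {f | has_content la f}.
pose J := {ffun 'I_(size la) * X -> 'I_n.+1}.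
pose K := (F * J)%type.
have <- : #|{: K}| = (#|[set f | has_content la f]| * n.+1 ^ (size la * #|X|))%N.
  by rewrite card_prod card_sig card_ffun card_prod !card_ord cardsE.
pose fg g : F := exist (fun f => has_content la f) (row_word e g) (row_word_content e g).
pose V g y : W := sact g^-1 (ysym la (sact g (word_vec y))).
(* The common value of [V g y] on the words of joint type [c]; 0 if no word has this type. *)
pose phi g y (c : J) : C :=
  if [pick x | joint_type (row_word e g) x == c] is Some x then V g y x else 0.
have phiE g y x : phi g y (joint_type (row_word e g) x) = V g y x.
  rewrite /phi; case: pickP => [x' /eqP jx|/(_ x)]; last by rewrite eqxx.
  exact: sact_ysym_joint.
pose A : 'M[C]_(#|Wd|, #|{: K}|) := \matrix_(a, k)
  (joint_type (sval (enum_val k).1) (enum_val a) == (enum_val k).2)%:R.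
pose B : 'M[C]_(#|{: K}|, #|Wd|) := \matrix_(k, b)
  (ecoef R n la * \sum_(g | fg g == (enum_val k).1) phi g (enum_val b) (enum_val k).2).
(* The sum over [g] in [zact] is grouped by the row word of [g]; [A] selects the joint type of the
   word at which the result is evaluated. *)
have -> : M = A *m B.
  apply/matrixP => a b; rewrite !mxE pactE ffunE /zact sum_ffunE [LHS]mulr_sumr.
  under [RHS]eq_bigr => k _ do rewrite !mxE.
  rewrite (reindex (@enum_rank K)) /=; last exact/onW_bij/enum_rank_bij.
  under [RHS]eq_bigr => k _ do rewrite enum_rankK.
  rewrite -(pair_bigA _ (fun (f : F) (c : J) =>
     (joint_type (sval f) (enum_val a) == c)%:R *
     (ecoef R n la * \sum_(g | fg g == f) phi g (enum_val b) c))) /=.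
  rewrite (partition_big fg xpredT) //=; apply: eq_bigr => f _.
  rewrite (bigD1 (joint_type (sval f) (enum_val a))) //= eqxx mul1r.
  rewrite [X in _ = _ + X]big1 ?addr0 => [|c /negPf ne]; last first.
    by rewrite eq_sym ne mul0r.
  rewrite mulr_sumr; apply: eq_bigr => g /eqP <- /=.
  by rewrite phiE.
by apply: leq_trans (mxrankM_maxl _ _) _; exact: rank_leq_col.
Qed.

(** The first column has more boxes than there are letters, so two of them carry the same letter.
    Their transposition fixes the word but changes the sign. *)
Lemma colasym_long0 la (T : W) : is_part n la -> (#|X| < size la)%N ->
  colasym la T = 0.
Proof.
move=> /and3P[_ la0 /eqP e] lt; apply/ffunP => x; rewrite [RHS]ffunE.
have la_gt0 (k : 'I_(size la)) : (0 < nth 0%N la k)%N.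
  by rewrite lt0n; apply: contraNneq la0 => <-; exact: mem_nth.
have box_lt (k : 'I_(size la)) : (flatten_index la k 0 < n)%N.
  by rewrite -[X in (_ < X)%N]e; apply: flatten_indexP.
pose box k := Ordinal (box_lt k).
have /injectivePn[k [l kl xkl]] : ~~ injectiveb (fun k => x (box k)).
  apply/negP => /injectiveP/leq_card; rewrite card_ord leqNgt lt //.
have ne : box k != box l.
  apply: contraNneq kl => /(congr1 val) /= /(congr1 (reshape_index la)).
  by rewrite !flatten_indexKl // => /val_inj ->.
have off : reshape_offset la (box k) = reshape_offset la (box l).
  by rewrite /= !flatten_indexKr.
have := sact_colasym T ne off => /ffunP/(_ x); rewrite ffunE [in RHS]ffunE.
have -> : [ffun i => x (tperm (box k) (box l) i)] = x.
  by apply/ffunP => i; rewrite ffunE; case: tpermP => [->|->|].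
move/eqP; rewrite -addr_eq0 -mulr2n -mulr_natl mulf_eq0 pnatr_eq0 => /eqP.
exact.
Qed.

Lemma pact_long0 la (T : W) : is_part n la -> (#|X| < size la)%N -> pact la T = 0.
Proof.
move=> pla lt; rewrite pactE /zact big1 ?scaler0 // => g _.
by rewrite /ysym colasym_long0 // !linear0.
Qed.

End TraceBound.

Lemma size_short_parts n d (L : seq (seq nat)) : uniq L ->
  (forall la, la \in L -> is_part n la && (size la <= d)%N) ->
  (size L <= n.+1 ^ d)%N.
Proof.
move=> uL hL; pose F (la : seq nat) : {ffun 'I_d -> 'I_n.+1} :=
  [ffun k : 'I_d => inord (nth 0%N la k)].
have Finj : {in L &, injective F}.
  move=> la mu laL muL /ffunP eF.
  have /andP[/and3P[_ la0 /eqP la_n] las] := hL la laL.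
  have /andP[/and3P[_ mu0 /eqP mu_n] mus] := hL mu muL.
  have nle (nu : seq nat) k : sumn nu = n -> (nth 0%N nu k <= n)%N.
    move=> <-; apply: (@leq_trans (sumn (take k.+1 nu))).
      by rewrite sumn_take_S leq_addl.
    by rewrite -{2}(cat_take_drop k.+1 nu) sumn_cat leq_addr.
  have nthE k : nth 0%N la k = nth 0%N mu k.
    have [lt|ge] := ltnP k d; last by rewrite !nth_default // (leq_trans _ ge).
    have := congr1 val (eF (Ordinal lt)); rewrite !ffunE /= !inordK ?ltnS //; exact: nle.
  apply: dominance_anti => //; elim=> [|r IHr]; first by rewrite !take0.
  by rewrite !sumn_take_S IHr nthE.
rewrite -(size_map F) -[X in (_ <= X ^ _)%N]card_ord -[X in (_ <= _ ^ X)%N]card_ord.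
rewrite -card_ffun -(card_uniqP _) ?max_card //.
by rewrite map_inj_in_uniq.
Qed.

(** * Estimates *)

Section Estimates.
Variable R : realType.

(** Invert [1 - v <= expR (- v)] and use (1 + v + 2 v^2)(1 - v) = 1 + v^2 (1 - 2 v), which is at
    least 1 for [v <= 1/2]. *)
Lemma expR_le_quad (v : R) : v <= 2^-1 -> expR v <= 1 + v + 2 * v ^+ 2.
Proof.
move=> hv; have h1 : 1 - v <= expR (- v) by exact: expR_ge1Dx.
have p1 : 0 < 1 - v by lra.
rewrite -[v]opprK expRN -[leRHS]divr1 ler_pdivlMr ?ltr01 // mulr1.
apply: (@le_trans _ _ (1 - v)^-1); first by rewrite lef_pV2 ?posrE ?expR_gt0.
rewrite opprK -[leLHS]mul1r ler_pdivrMr //.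
have -> : (1 + v + 2 * v ^+ 2) * (1 - v) = 1 + v ^+ 2 * (1 - 2 * v) by ring.
by rewrite lerDl mulr_ge0 ?sqr_ge0 //; lra.
Qed.

(* The derivative of the left-hand side at [s = 0] is [-delta]. *)
Lemma chernoff_rate (I : finType) (r : I -> R) (delta : R) :
  (forall i, 0 <= r i) -> \sum_i r i = 1 -> 0 < delta ->
  let c := - \sum_i r i * ln (r i) - delta in
  exists2 s, 0 < s & \sum_i r i * expR (s * (ln (r i) + c)) < 1.
Proof.
move=> r0 r1 d0 c; pose w i := ln (r i) + c.
pose K := 1 + \sum_i `|w i|.
have K1 : 1 <= K by rewrite lerDl sumr_ge0.
have wK i : `|w i| <= K.
  rewrite /K (bigD1 i) //= addrCA lerDl addr_ge0 ?ler01 //.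
  by apply: sumr_ge0.
have K0 : 0 < K by lra.
(* The first bound gives [s * w i <= 1/2], as [expR_le_quad] requires; the second makes the
   quadratic term at most half of the linear gain [s * delta]. *)
pose s := Num.min (2 * K)^-1 (delta / (4 * K ^+ 2)).
have s0 : 0 < s.
  by rewrite lt_min invr_gt0 divr_gt0 ?mulr_gt0 ?exprn_gt0.
exists s => //.
have sw i : s * w i <= 2^-1.
  apply: le_trans (ler_norm _) _; rewrite normrM (gtr0_norm s0).
  apply: (@le_trans _ _ ((2 * K)^-1 * K)).
    by apply: ler_pM => //; [exact: ltW | rewrite /s ge_min lexx].
  by rewrite invfM mulfVK ?gt_eqF.
have : \sum_i r i * expR (s * (ln (r i) + c)) <=
       \sum_i (r i + s * (r i * ln (r i)) + s * c * r i + 2 * s ^+ 2 * K ^+ 2 * r i).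
  apply: ler_sum => i _; rewrite -/(w i).
  have -> : r i + s * (r i * ln (r i)) + s * c * r i + 2 * s ^+ 2 * K ^+ 2 * r i
     = r i * (1 + s * w i + 2 * (s * K) ^+ 2) by rewrite /w; ring.
  apply: ler_wpM2l => //; apply: le_trans (expR_le_quad (sw i)) _.
  rewrite lerD2l ler_wpM2l // -[leLHS]real_normK ?num_real // normrM (gtr0_norm s0).
  by rewrite ler_pXn2r ?nnegrE ?mulr_ge0 ?(ltW s0) ?(ltW K0) // ler_wpM2l ?(ltW s0).
move=> h; apply: le_lt_trans h _.
rewrite !big_split /= -!mulr_sumr r1.
have -> : 1 + s * (\sum_i r i * ln (r i)) + s * c * 1 + 2 * s ^+ 2 * K ^+ 2 * 1
  = 1 - s * (delta - 2 * s * K ^+ 2) by rewrite /c; ring.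
have hs : s * (4 * K ^+ 2) <= delta.
  by rewrite -ler_pdivlMr ?mulr_gt0 ?exprn_gt0 // /s ge_min lexx orbT.
rewrite ltrBlDr ltrDl mulr_gt0 //.
have -> : 2 * s * K ^+ 2 = s * (4 * K ^+ 2) / 2 by field.
lra.
Qed.

(** Words of probability at least [expR (- (n%:R * c))] are handled by an exponential Markov bound
    with [D x <= 1]; each remaining word has probability below that threshold, and the total of [D]
    is at most [B]. *)
Lemma typical_weight (I : finType) (n : nat) (r : I -> R) (s c B : R)
    (D : {ffun 'I_n -> I} -> R) :
  (forall i, 0 <= r i) -> 0 < s ->
  (forall x, 0 <= D x <= 1) -> \sum_x D x <= B ->
  \sum_(x : {ffun 'I_n -> I}) (\prod_i r (x i)) * D x <=
  (\sum_i r i * expR (s * (ln (r i) + c))) ^+ n + expR (- (n%:R * c)) * B.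
Proof.
move=> r0 s0 D01 DB.
apply: (@le_trans _ _ (\sum_(x : {ffun 'I_n -> I})
    (\prod_i (r (x i) * expR (s * (ln (r (x i)) + c)))
     + expR (- (n%:R * c)) * D x))); last first.
  rewrite big_split /= -mulr_sumr; apply: lerD; last by rewrite ler_wpM2l ?expR_ge0.
  rewrite -[in leRHS](card_ord n) -prodr_const.
  by rewrite bigA_distr_bigA.
apply: ler_sum => x _; have /andP[Dx0 Dx1] := D01 x.
have w0 : 0 <= \prod_i r (x i) by apply: prodr_ge0.
(* Words of probability zero are set apart: [ln] has the default value 0 at 0, so the product is not
   the exponential of the sum of logarithms there. *)
have [z|nz] := eqVneq (\prod_i r (x i)) 0.
  rewrite z mul0r addr_ge0 ?mulr_ge0 ?expR_ge0 //.
  by apply: prodr_ge0 => i _; rewrite mulr_ge0 ?expR_ge0.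
have rpos i : 0 < r (x i).
  rewrite lt_def r0 andbT; apply: contraNneq nz => ri0.
  by apply/prodf_eq0; exists i; rewrite ?ri0.
have wE : \prod_i r (x i) = expR (\sum_i ln (r (x i))).
  by rewrite expR_sum; apply: eq_bigr => i _; rewrite lnK // posrE.
have -> : \prod_i (r (x i) * expR (s * (ln (r (x i)) + c))) =
   (\prod_i r (x i)) * expR (s * (\sum_i ln (r (x i)) + n%:R * c)).
  rewrite big_split /=; congr (_ * _); rewrite -expR_sum; congr expR.
  by rewrite -mulr_sumr big_split /= sumr_const card_ord mulr_natl.
have [le0|gt0] := leP 0 (\sum_i ln (r (x i)) + n%:R * c).
  rewrite -[leLHS]addr0 lerD ?mulr_ge0 ?expR_ge0 // ler_wpM2l //.
  by apply: le_trans Dx1 _; rewrite -[leLHS]expR0 ler_expR mulr_ge0 // ltW.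
rewrite -[leLHS]add0r lerD ?mulr_ge0 ?expR_ge0 // ler_wpM2r //.
by rewrite wE ler_expR; lra.
Qed.

Lemma poly_exp_small (a eta : R) (k : nat) : 0 < a -> 0 < eta ->
  exists N : nat, forall n, (N <= n)%N ->
    (n.+1%:R ^+ k) * expR (- (n%:R * a)) < eta.
Proof.
(* Bounding [expR (n%:R * a)] below by its term of degree [k.+1], and n + 1 by 2 n, leaves exactly K
   / n. *)
move=> a0 eta0; pose K := 2 ^+ k * (k.+1)`!%:R / a ^+ k.+1.
have K0 : 0 < K by rewrite divr_gt0 ?mulr_gt0 ?exprn_gt0 // ltr0n fact_gt0.
exists (Num.bound (K / eta)).+1 => n hn.
have n0 : 0 < n%:R :> R by rewrite ltr0n (leq_trans _ hn).
have nK : K / eta < n%:R.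
  apply: lt_trans (archi_boundP _) _; first by rewrite ltW // divr_gt0.
  by rewrite ltr_nat.
apply: (@le_lt_trans _ _ (K / n%:R)); last first.
  by rewrite ltr_pdivrMr // mulrC -ltr_pdivrMr.
have hexp : (n%:R * a) ^+ k.+1 / (k.+1)`!%:R <= expR (n%:R * a).
  apply: le_trans (expR_ge1Dxn k _); last by rewrite mulr_ge0 // ltW.
  by rewrite lerDr.
have hn2 : n.+1%:R ^+ k <= (2 * n%:R) ^+ k :> R.
  have n1 : 1 <= n%:R :> R by rewrite ler1n (leq_trans _ hn).
  apply: lerXn2r; rewrite ?nnegrE ?mulr_ge0 // -natr1; lra.
rewrite expRN ler_pdivrMr ?expR_gt0 //.
apply: le_trans hn2 _.
apply: (@le_trans _ _ (K / n%:R * ((n%:R * a) ^+ k.+1 / (k.+1)`!%:R))); last first.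
  by rewrite ler_wpM2l // ltW // divr_gt0.
have f0 : (k.+1)`!%:R != 0 :> R by rewrite pnatr_eq0 -lt0n fact_gt0.
rewrite /K !exprMn [(n%:R) ^+ k.+1]exprS le_eqVlt; apply/orP; left; apply/eqP.
have a1 : a ^+ k.+1 != 0 by rewrite expf_neq0 ?gt_eqF.
field; rewrite f0 a1 gt_eqF //.
Qed.

(** Draw the letters independently with distribution [la / n]: every word of content [la] has the
    same probability, the inverse of the right-hand side, and the total is at most 1. *)
Lemma content_count n la : is_part n la -> (0 < n)%N ->
  (#|[set f : {ffun 'I_n -> 'I_(size la)} | has_content f]|)%:R <=
  expR (n%:R * (shannon_part R n la * ln 2)).
Proof.
move=> /and3P[_ la0 /eqP la_n] n0.
have nR : 0 < n%:R :> R by rewrite ltr0n.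
pose w (k : 'I_(size la)) : R := (nth 0%N la k)%:R / n%:R.
have wpos k : 0 < w k.
  rewrite divr_gt0 // ltr0n lt0n; apply: contraNneq la0 => <-; exact: mem_nth.
have w1 : \sum_k w k = 1.
  rewrite -mulr_suml -natr_sum -[X in X%:R / _]/(\sum_(i < size la) nth 0%N la i)%N.
  rewrite -(big_mkord xpredT (nth 0%N la)) -(big_nth 0%N xpredT id) -sumnE la_n.
  by rewrite divff // gt_eqF.
have ln2 : ln 2 != 0 :> R by rewrite gt_eqF // ln_gt0 // ltr1n.
have HE : n%:R * (shannon_part R n la * ln 2) =
   - \sum_(k < size la) (nth 0%N la k)%:R * ln (w k).
  rewrite /shannon_part mulNr mulrN mulr_suml mulr_sumr (big_nth 0%N) big_mkord.
  congr (- _); apply: eq_bigr => k _; rewrite /log2 -/(w k) {1}/w.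
  by field; rewrite ln2 gt_eqF.
rewrite HE expRN -[leRHS]mul1r ler_pdivlMr ?expR_gt0 //.
have wf1 : \sum_(f : {ffun 'I_n -> 'I_(size la)}) \prod_i w (f i) = 1.
  rewrite -(bigA_distr_bigA (fun (i : 'I_n) k => w k)) /= prodr_const w1.
  by rewrite expr1n.
rewrite -sum1_card natr_sum mulr_suml -[leRHS]wf1.
rewrite [leRHS](bigID (mem [set f | has_content f])) /=.
rewrite -[leLHS]addr0 lerD //; last first.
  by apply: sumr_ge0 => f _; apply: prodr_ge0 => i _; exact: ltW.
apply: ler_sum => f; rewrite inE => /forallP hf; rewrite mul1r.
rewrite expR_sum [leRHS](partition_big f xpredT) //= le_eqVlt; apply/orP; left.
apply/eqP/eq_bigr => k _.
rewrite (eq_bigr (fun=> w k)) => [|i /eqP -> //].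
rewrite prodr_const expRM_natl lnK ?posrE //; congr (_ ^+ _).
by rewrite -(eqP (hf k)); apply: eq_card => i; rewrite inE.
Qed.

End Estimates.

(** * Weight of an isotypic component *)

Local Open Scope sesquilinear_scope.

Lemma prod_delta (K : comPzSemiRingType) (I : finType) (J : eqType)
    (a : I -> K) (x y : {ffun I -> J}) :
  \prod_i (a i * (x i == y i)%:R) = (x == y)%:R * \prod_i a i.
Proof.
have [->|ne] := eqVneq x y.
  by rewrite mul1r; apply: eq_bigr => i _; rewrite eqxx mulr1.
rewrite mul0r; have /existsP[i /negPf xyi] : [exists i, x i != y i].
  rewrite -negb_forall; apply: contra ne => /forallP h.
  by apply/eqP/ffunP => i; apply/eqP.
by rewrite (bigD1 i) //= xyi mulr0 mul0r.
Qed.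

Lemma sum_prod_ffun (K : comPzSemiRingType) (I J : finType) (F : I -> J -> K) :
  \sum_(x : {ffun I -> J}) \prod_i F i (x i) = \prod_i \sum_j F i j.
Proof. by rewrite bigA_distr_bigA. Qed.

(** * Tensor powers of unitary matrices *)

Section UnitaryAction.
Variables (R : realType) (n : nat) (X : finType).
Local Notation C := (R[i]).

Lemma dot_glact (U : 'M[C]_#|X|) (T T' : tpow R X n) : U \is unitarymx ->
  dot (glact U T) (glact U T') = dot T T'.
Proof.
move=> /unitarymxP/mulmx1C UU.
have colU (u v : X) : \sum_(w : X)
    U (enum_rank w) (enum_rank u) * conjc (U (enum_rank w) (enum_rank v)) = (u == v)%:R.
  have := congr1 (fun M : 'M_#|X| => M (enum_rank v) (enum_rank u)) UU.
  rewrite !mxE (inj_eq enum_rank_inj) eq_sym => <-.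
  rewrite [RHS](reindex (@enum_rank X)) /=; last exact/onW_bij/enum_rank_bij.
  by apply: eq_bigr => w _; rewrite !mxE mulrC.
rewrite /dot.
transitivity (\sum_y \sum_z T y * conjc (T' z) * \sum_(x : {ffun 'I_n -> X})
   \prod_i (U (enum_rank (x i)) (enum_rank (y i)) *
            conjc (U (enum_rank (x i)) (enum_rank (z i))))).
  under eq_bigr => x _.
    rewrite !ffunE rmorph_sum /= big_distrlr /=.
    over.
  rewrite exchange_big /=; apply: eq_bigr => y _.
  rewrite exchange_big /=; apply: eq_bigr => z _.
  rewrite mulr_sumr; apply: eq_bigr => x _.
  rewrite big_split /= -rmorph_prod rmorphM /=.
  by rewrite mulrACA mulrC.
have colUn (y z : {ffun 'I_n -> X}) : \sum_(x : {ffun 'I_n -> X})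
   \prod_i (U (enum_rank (x i)) (enum_rank (y i)) *
            conjc (U (enum_rank (x i)) (enum_rank (z i)))) = (y == z)%:R.
  pose F (i : 'I_n) (w : X) : C := U (enum_rank w) (enum_rank (y i)) *
            conjc (U (enum_rank w) (enum_rank (z i))).
  transitivity (\prod_i \sum_w F i w); first by rewrite -sum_prod_ffun.
  under eq_bigr => i _ do rewrite /F colU -[(_ == _)%:R]mul1r.
  by rewrite prod_delta big1 ?mulr1.
apply: eq_bigr => y _.
transitivity (\sum_z T y * conjc (T' z) * (y == z)%:R).
  by apply: eq_bigr => z _; congr (_ * _); exact: colUn.
rewrite (bigD1 y) //= big1 ?addr0 ?eqxx ?mulr1 // => z zy.
by rewrite eq_sym (negPf zy) mulr0.
Qed.

End UnitaryAction.

(** * The spectrum of a marginal and the weights of isotypic components *)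

Section Weight.
Variables (R : realType) (X Y : finType).
Local Notation C := (R[i]).
Variable V : X -> Y -> C.

Definition vnorm : C := \sum_x \sum_y V x y * conjc (V x y).

Definition vmarg : 'M[C]_#|X| :=
  \matrix_(a, b) \sum_c V (enum_val a) c * conjc (V (enum_val b) c) / vnorm.

Hypothesis V0 : vnorm != 0.

Definition vspec (x : X) : R := complex.Re (spectral_diag vmarg 0 (enum_rank x)).

Lemma vnorm_ge0 : 0 <= vnorm.
Proof. by do 2!apply: sumr_ge0 => ? _; exact: mulcJ_ge0. Qed.

Lemma vnorm_gt0 : 0 < vnorm.
Proof. by rewrite lt_def V0 vnorm_ge0. Qed.

Lemma vmarg_herm : vmarg ^t* = vmarg.
Proof.
have Nr : conjc vnorm = vnorm by exact: geC0_conj vnorm_ge0.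
apply/matrixP => a b; rewrite !mxE.
change (conjc (\sum_c V (enum_val b) c * conjc (V (enum_val a) c) / vnorm) =
  \sum_c V (enum_val a) c * conjc (V (enum_val b) c) / vnorm).
rewrite rmorph_sum; apply: eq_bigr => c _ /=.
rewrite !rmorphM /= conjcK conjc_inv Nr; congr (_ / _); exact: mulrC.
Qed.

Lemma vmarg_spectral : vmarg =
  invmx (spectralmx vmarg) *m diag_mx (spectral_diag vmarg) *m spectralmx vmarg.
Proof. by apply/orthomx_spectralP/normalmxP; rewrite vmarg_herm. Qed.

(** [V] with its first leg written in the eigenbasis of the marginal: the Schmidt form, in which the
    rows are orthogonal. *)
Definition vrot (x : X) (c : Y) : C :=
  \sum_x' spectralmx vmarg (enum_rank x) (enum_rank x') * V x' c.

(** Up to the factor [vnorm], the Gram matrix of the rows of [vrot] is the marginal conjugated by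
    its diagonalising unitary. *)
Lemma vrot_ortho0 x x' : \sum_c vrot x c * conjc (vrot x' c) =
  vnorm * (spectral_diag vmarg 0 (enum_rank x) * (x == x')%:R).
Proof.
set U := spectralmx vmarg; have uU : U \is unitarymx by exact: spectral_unitarymx.
have -> : spectral_diag vmarg 0 (enum_rank x) * (x == x')%:R =
    (U *m vmarg *m U^t*) (enum_rank x) (enum_rank x').
  rewrite [X in U *m X]vmarg_spectral -/U !mulmxA mulmxV ?unitarymx_unit // mul1mx.
  rewrite -invmx_unitary // mulmxK ?unitarymx_unit // !mxE.
  by rewrite (inj_eq enum_rank_inj) mulr_natr.
rewrite mxE mulr_sumr.
under [RHS]eq_bigr => b _ do rewrite !mxE mulr_suml mulr_sumr.
rewrite (reindex (@enum_rank X)) /=; last exact/onW_bij/enum_rank_bij.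
under [RHS]eq_bigr => b _.
  rewrite (reindex (@enum_rank X)) /=; last exact/onW_bij/enum_rank_bij.
  under eq_bigr => a _ do rewrite !mxE !enum_rankK mulr_sumr mulr_suml mulr_sumr.
  over.
rewrite /vrot.
under [LHS]eq_bigr => c _.
  rewrite rmorph_sum /= big_distrlr /=.
  over.
rewrite [LHS]exchange_big /= [RHS]exchange_big /=; apply: eq_bigr => a _.
rewrite [LHS]exchange_big /=; apply: eq_bigr => b _; apply: eq_bigr => c _.
rewrite rmorphM /=.
set u := spectralmx _ _ _; set v := conjc _; set w := conjc _.
rewrite -/vnorm; apply: (mulIf V0); rewrite -!mulrA.
rewrite [in RHS](mulrC vnorm) -!mulrA.
rewrite [X in _ = _ * (_ * (_ * X))]mulrCA.
rewrite (mulrA (vnorm^-1)) mulVf // mul1r.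
by congr (_ * (_ * _)); rewrite mulrCA.
Qed.

Lemma spectral_diag_ge0 x : 0 <= spectral_diag vmarg 0 (enum_rank x).
Proof.
rewrite -(pmulr_rge0 _ vnorm_gt0) -[X in vnorm * X]mulr1.
have := vrot_ortho0 x x; rewrite eqxx => <-.
by apply: sumr_ge0 => c _; exact: mulcJ_ge0.
Qed.

Lemma vspecE x : spectral_diag vmarg 0 (enum_rank x) = (vspec x)%:C.
Proof. by rewrite RRe_real // ger0_real // spectral_diag_ge0. Qed.

Lemma vspec_ge0 x : 0 <= vspec x.
Proof. by rewrite -ler0c -vspecE spectral_diag_ge0. Qed.

Lemma vrot_ortho x x' : \sum_c vrot x c * conjc (vrot x' c) =
  vnorm * (vspec x)%:C * (x == x')%:R.
Proof. by rewrite vrot_ortho0 vspecE mulrA. Qed.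

Lemma sum_vspec : \sum_x vspec x = 1.
Proof.
apply: complexI; rewrite rmorph_sum /=.
under eq_bigr => x _ do rewrite -vspecE.
rewrite -(reindex (@enum_rank X) (P := xpredT) (F := fun i => spectral_diag vmarg 0 i));
  last exact/onW_bij/enum_rank_bij.
rewrite -mxtrace_diag.
have -> : \tr (diag_mx (spectral_diag vmarg)) = \tr vmarg.
  rewrite [in RHS]vmarg_spectral -mulmxA mxtrace_mulC -mulmxA mulmxV ?mulmx1 //.
  exact: spectral_unit.
rewrite /mxtrace (reindex (@enum_rank X)) /=; last exact/onW_bij/enum_rank_bij.
under eq_bigr => x _ do rewrite mxE enum_rankK -mulr_suml.
by rewrite -mulr_suml -/vnorm divff.
Qed.

Lemma vN_entropy_vmarg :
  vN_entropy vmarg = - \sum_x vspec x * log2 (vspec x).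
Proof.
rewrite /vN_entropy /mxlog2; set L := diag_mx (map_mx _ _).
have -> : \tr (vmarg *m (invmx (spectralmx vmarg) *m L *m spectralmx vmarg)) =
   \tr (diag_mx (spectral_diag vmarg) *m L).
  rewrite [in X in X *m _]vmarg_spectral -!mulmxA (mulKVmx (spectral_unit _)).
  by rewrite mxtrace_mulC -!mulmxA mulmxV ?mulmx1 // spectral_unit.
rewrite /L mulmx_diag mxtrace_diag raddfN /=; congr (- _).
rewrite (reindex (@enum_rank X)) /=; last exact/onW_bij/enum_rank_bij.
apply: complexI.
transitivity (\sum_x (vspec x * log2 (vspec x))%:C : C); last by rewrite rmorph_sum.
rewrite (_ : \sum_j _ = \sum_x (vspec x * log2 (vspec x))%:C).
  by rewrite -rmorph_sum.
by apply: eq_bigr => x _; rewrite !mxE vspecE -rmorphM.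
Qed.

Section Power.
Variable n : nat.

Definition vpow (y : {ffun 'I_n -> Y}) : tpow R X n :=
  [ffun x : {ffun 'I_n -> X} => \prod_i V (x i) (y i)].

Lemma glact_vpow y : glact (spectralmx vmarg) (vpow y) =
  [ffun x : {ffun 'I_n -> X} => \prod_i vrot (x i) (y i)].
Proof.
apply/ffunP => x; rewrite !ffunE /vrot -sum_prod_ffun.
by apply: eq_bigr => x' _; rewrite ffunE -big_split.
Qed.

(** Rotation to the eigenbasis preserves inner products and commutes with [pact]. Summing over [y]
    first, the orthogonality of the rows of [vrot] leaves only the diagonal entries of the
    projection. *)
Lemma sum_dot_pact_vpow la : la \in cycle_types n ->
  \sum_y dot (pact la (vpow y)) (pact la (vpow y)) =
  vnorm ^+ n * \sum_(x : {ffun 'I_n -> X}) (\prod_i vspec (x i))%:C * pdiag R la x.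
Proof.
move=> laL; pose vr (y : {ffun 'I_n -> Y}) : tpow R X n :=
  [ffun x : {ffun 'I_n -> X} => \prod_i vrot (x i) (y i)].
pose p (x' x : {ffun 'I_n -> X}) : C := pact la (word_vec R x) x'.
have step y : dot (pact la (vpow y)) (pact la (vpow y)) =
    \sum_x \sum_x' p x' x * \prod_i (vrot (x i) (y i) * conjc (vrot (x' i) (y i))).
  rewrite -(dot_glact _ _ (spectral_unitarymx vmarg)).
  rewrite /pact -!galgact_glact -!/(pact _ _) glact_vpow -/(vr y).
  rewrite dot_pact // pact_idem // -dot_pact //.
  rewrite {1}(word_vecE (vr y)) linear_sum /= dot_suml; apply: eq_bigr => x _.
  rewrite linearZ /= dotZl /dot mulr_sumr; apply: eq_bigr => x' _.
  rewrite big_split /= -rmorph_prod !ffunE mulrCA; congr (_ * (_ * _)).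
under eq_bigr => y _ do rewrite step.
rewrite exchange_big mulr_sumr /=; apply: eq_bigr => x _.
rewrite exchange_big /=.
have orth (x' : {ffun 'I_n -> X}) : \sum_(y : {ffun 'I_n -> Y})
    \prod_i (vrot (x i) (y i) * conjc (vrot (x' i) (y i))) =
    (x == x')%:R * (vnorm ^+ n * (\prod_i vspec (x i))%:C).
  pose F (i : 'I_n) (c : Y) : C := vrot (x i) c * conjc (vrot (x' i) c).
  transitivity (\prod_i \sum_c F i c); first by rewrite -sum_prod_ffun.
  under eq_bigr => i _ do rewrite /F vrot_ortho.
  rewrite prod_delta big_split /= prodr_const card_ord.
  by rewrite rmorph_prod.
transitivity (\sum_x' p x' x * ((x == x')%:R * (vnorm ^+ n * (\prod_i vspec (x i))%:C))).
  by apply: eq_bigr => x' _; rewrite -mulr_sumr; congr (_ * _); exact: orth.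
rewrite (bigD1 x) //= [X in _ + X]big1 ?addr0 => [|x' ne].
  by rewrite eqxx mul1r mulrC -mulrA.
by rewrite eq_sym (negPf ne) mul0r mulr0.
Qed.

End Power.

End Weight.

(** * Partitions of too small entropy carry little weight *)

Section BadWeight.
Variables (R : realType) (X Y : finType).
Local Notation C := (R[i]).
Variable V : X -> Y -> C.
Hypothesis V0 : vnorm V != 0.

Let r := vspec V.
Let H := vN_entropy (vmarg V).
Let d := #|X|.

(** The trace of the isotypic projection against the [n]-th tensor power of the marginal. *)
Definition pweight n la : R :=
  \sum_(x : {ffun 'I_n -> X}) (\prod_i r (x i)) * complex.Re (pdiag R la x).

Lemma sum_dot_pact_pweight n la : la \in cycle_types n ->
  \sum_(y : {ffun 'I_n -> Y}) dot (pact la (vpow V y)) (pact la (vpow V y)) =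
  vnorm V ^+ n * (pweight n la)%:C.
Proof.
move=> laL; rewrite sum_dot_pact_vpow // rmorph_sum /=; congr (_ * _).
apply: eq_bigr => x _; rewrite rmorphM /= RRe_real //.
by rewrite ger0_real // pdiag_ge0.
Qed.

Lemma entropy_nat : H * ln 2 = - \sum_x r x * ln (r x).
Proof.
rewrite /H vN_entropy_vmarg // mulNr mulr_suml; congr (- _).
apply: eq_bigr => x _; rewrite /log2 -mulrA divfK // gt_eqF //.
by rewrite ln_gt0 // ltr1n.
Qed.

(** [typical_weight] is applied with [D] the diagonal of the projection: [chernoff_rate] controls
    the first term, and the trace bound with [content_count] the second. *)
Lemma pweight_le (eps : R) : 0 < eps -> exists2 a, 0 < a & forall n la, (0 < n)%N ->
  la \in cycle_types n -> (size la <= d)%N -> shannon_part R n la <= H - eps ->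
  pweight n la <= expR (- (n%:R * a)) + n.+1%:R ^+ (d * d) * expR (- (n%:R * a)).
Proof.
move=> eps0; have ln2 : 0 < ln 2 :> R by rewrite ln_gt0 // ltr1n.
(* Half of [eps], in natural units: the loss [delta] in [c] is half of the gap in entropy, so the
   exponent in the second term is [- (n%:R * delta)]. *)
pose delta := eps * ln 2 / 2.
have d0 : 0 < delta by rewrite divr_gt0 // mulr_gt0.
have [s s0] := chernoff_rate (vspec_ge0 V0) (sum_vspec V0) d0.
rewrite -entropy_nat; set c := _ - delta; set q := \sum_i _ => q1.
have q0 : 0 <= q by apply: sumr_ge0 => i _; rewrite mulr_ge0 ?expR_ge0 ?vspec_ge0.
exists (Num.min (1 - q) delta); first by rewrite lt_min d0 subr_gt0 q1.
move=> n la n0 laL sla bad; set a := Num.min _ _.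
pose B : R := (#|[set f : {ffun 'I_n -> 'I_(size la)} | has_content f]|
  * n.+1 ^ (size la * d))%:R.
have h : pweight n la <= q ^+ n + expR (- (n%:R * c)) * B.
  apply: typical_weight => //; first exact: vspec_ge0.
    move=> x; have := pdiag_ge0 R x laL; have := pdiag_le1 R x laL.
    by rewrite !lecE /= => /andP[_ ->] /andP[_ ->].
  rewrite -lecR rmorph_sum /= [leRHS]rmorph_nat.
  apply: le_trans (sum_pdiag_le R X laL); rewrite le_eqVlt; apply/orP; left.
  by apply/eqP/eq_bigr => x _; rewrite RRe_real // ger0_real // pdiag_ge0.
apply: le_trans h _; apply: lerD.
  (* This is [q <= expR (q - 1)] together with [a <= 1 - q]. *)
  have : q <= expR (- a).
    apply: le_trans (expR_ge1Dx _); rewrite -lerBlDl; rewrite lerNr opprB /a ge_min.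
    by rewrite lexx.
  move=> qa; apply: le_trans (lerXn2r _ _ _ qa) _; rewrite ?nnegrE ?expR_ge0 //.
  by rewrite -expRM_natl mulrN.
have B1 : B <= expR (n%:R * ((H - eps) * ln 2)) * n.+1%:R ^+ (d * d).
  rewrite /B natrM natrX; apply: ler_pM => //.
    apply: le_trans (content_count R (cycle_types_part laL) n0) _.
    by rewrite ler_expR ler_wpM2l // ler_wpM2r // ltW.
  by rewrite ler_weXn2l ?ler1n // leq_mul2r sla orbT.
apply: le_trans (ler_wpM2l (expR_ge0 _) B1) _.
rewrite [leLHS]mulrA -expRD [leRHS]mulrC ler_wpM2r ?exprn_ge0 // ler_expR.
have -> : - (n%:R * c) + n%:R * ((H - eps) * ln 2) = - (n%:R * delta).
  by rewrite /c /delta; field.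
by rewrite lerN2 ler_wpM2l // /a ge_min lexx orbT.
Qed.

(** Partitions with more than [d] rows contribute nothing; the others are polynomially many, each of
    exponentially small weight. *)
Lemma bad_weight_small (eps eta : R) : 0 < eps -> 0 < eta ->
  exists N, forall n, (N <= n)%N ->
  \sum_(la <- cycle_types n | shannon_part R n la <= H - eps)
    \sum_(y : {ffun 'I_n -> Y}) dot (pact la (vpow V y)) (pact la (vpow V y))
    <= vnorm V ^+ n * eta%:C.
Proof.
move=> eps0 eta0; have [a a0 ha] := pweight_le eps0.
have eta2 : 0 < eta / 2 by rewrite divr_gt0.
have [N1 hN1] := poly_exp_small d a0 eta2.
have [N2 hN2] := poly_exp_small (d + d * d) a0 eta2.
exists (maxn 1 (maxn N1 N2)) => n; rewrite !geq_max => /and3P[n0 nN1 nN2].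
rewrite (bigID (fun la => size la <= d)%N) /= [X in _ + X]big1_seq ?addr0; last first.
  move=> la /andP[/andP[_ sla] laL]; apply: big1 => y _.
  by rewrite pact_long0 ?dot0l ?cycle_types_part // ltnNge.
rewrite -big_filter; set L := filter _ _.
have LP la : la \in L -> [/\ la \in cycle_types n, (size la <= d)%N &
    shannon_part R n la <= H - eps].
  by rewrite mem_filter => /andP[/andP[-> ->] ->].
rewrite (eq_big_seq (fun la => vnorm V ^+ n * (pweight n la)%:C)); last first.
  by move=> la /LP[laL _ _]; exact: sum_dot_pact_pweight.
rewrite -mulr_sumr ler_wpM2l ?exprn_ge0 ?vnorm_ge0 // -rmorph_sum lecR.
pose K := expR (- (n%:R * a)) + n.+1%:R ^+ (d * d) * expR (- (n%:R * a)).
have K0 : 0 <= K by rewrite addr_ge0 ?mulr_ge0 ?exprn_ge0 ?expR_ge0.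
apply: (@le_trans _ _ (\sum_(la <- L) K)).
  rewrite big_seq [leRHS]big_seq; apply: ler_sum => la /LP[laL sla bad].
  exact: ha.
rewrite big_const_seq count_predT iter_addr_0 -mulr_natl.
have sL : (size L)%:R <= n.+1%:R ^+ d :> R.
  rewrite -natrX ler_nat; apply: size_short_parts.
    by rewrite filter_uniq // undup_uniq.
  by move=> la /LP[laL -> _]; rewrite cycle_types_part.
apply: le_trans (ler_wpM2r K0 sL) _; rewrite /K mulrDr mulrA -exprD.
have := hN1 n nN1; have := hN2 n nN2; lra.
Qed.

End BadWeight.

(** * Splitting off the legs in S *)

Section DependentDistr.
Variables (K : comPzSemiRingType) (I : finType) (T_ : I -> finType).
Variable F : forall i, T_ i -> K.

(** Distributivity for dependent functions, obtained from the non-dependent law over tagged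
    values. *)
Lemma sum_prod_dffun :
  \sum_(t : {dffun forall i, T_ i}) \prod_i @F i (t i) = \prod_i \sum_(l : T_ i) @F i l.
Proof.
pose P i : {ffun T_ i -> K} := finfun (@F i).
transitivity (\sum_(t : fprod T_) \prod_(i in I) P i (t i)).
  rewrite (reindex (@dffun_of_fprod I T_)) /=; last exact/onW_bij/dffun_of_fprod_bij.
  by apply: eq_bigr => t _; apply: eq_bigr => i _; rewrite !ffunE.
rewrite (@big_fprod K 0 1 *%R +%R I T_ P).
transitivity (\prod_i \sum_(j in tagged_with T_ i) untag 0 (P i) j).
  by rewrite bigA_distr_big_dep.
apply: eq_bigr => i _.
have := @big_tag K 0 +%R I T_ (fun i => P i) i.
by move=> <-; apply: eq_bigr => l _; rewrite ffunE.
Qed.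
End DependentDistr.

Section Glue.
Variables (k : nat) (d : 'I_k -> nat) (S : {set 'I_k}).

Lemma glueL (x : idxS d S) (y : idxS d (~: S)) (j : {j | j \in S}) :
  glue x y (val j) = x j.
Proof.
case: j => j hj; rewrite ffunE /=.
match goal with |- context [boolP ?b] => destruct (boolP b) as [h|h] end.
  by rewrite (bool_irrelevance hj h).
by case/negP: (h).
Qed.

Lemma glueR (x : idxS d S) (y : idxS d (~: S)) (j : {j | j \in ~: S}) :
  glue x y (val j) = y j.
Proof.
case: j => j hj; rewrite ffunE /=.
match goal with |- context [boolP ?b] => destruct (boolP b) as [h|h] end.
  by exfalso; move: hj; rewrite inE h.
by rewrite (bool_irrelevance hj (notin_setC h)).
Qed.

Lemma resS_glueL (x : idxS d S) (y : idxS d (~: S)) : resS S (glue x y) = x.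
Proof. by apply/ffunP => j; rewrite ffunE glueL. Qed.

Lemma resS_glueR (x : idxS d S) (y : idxS d (~: S)) : resS (~: S) (glue x y) = y.
Proof. by apply/ffunP => j; rewrite ffunE glueR. Qed.

Lemma glue_resS (z : idx d) : glue (resS S z) (resS (~: S) z) = z.
Proof.
apply/ffunP => j; rewrite ffunE.
by match goal with |- context [boolP ?b] => destruct (boolP b) end; rewrite ffunE.
Qed.

Lemma sum_glue (K : nmodType) (F : idx d -> K) :
  \sum_z F z = \sum_x \sum_y F (@glue _ _ S x y).
Proof.
rewrite (pair_bigA _ (fun x y => F (glue x y))) /=.
rewrite (reindex (fun p : idxS d S * idxS d (~: S) => glue p.1 p.2)) //.
exists (fun z => (resS S z, resS (~: S) z)) => [[x y] _|z _] /=.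
  by rewrite resS_glueL resS_glueR.
exact: glue_resS.
Qed.

Lemma prod_glue (K : comPzSemiRingType)
    (F : forall j, 'I_(d j) -> 'I_(d j) -> K) x y x' y' :
  \prod_j @F j (@glue _ _ S x y j) (glue x' y' j) =
  (\prod_(j : {j | j \in S}) @F (val j) (x j) (x' j)) *
  \prod_(j : {j | j \in ~: S}) @F (val j) (y j) (y' j).
Proof.
rewrite (bigID (mem S)) /=; congr (_ * _).
  rewrite big_sub; apply: eq_bigr => j _.
  by rewrite !glueL.
rewrite (eq_bigl (mem (~: S))) => [|j]; last by rewrite !inE.
by rewrite big_sub; apply: eq_bigr => j _; rewrite !glueR.
Qed.

Variables (R : realType) (n : nat).
Local Notation C := (R[i]).
Local Notation X := (idxS d S).
Local Notation Y := (idxS d (~: S)).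
Implicit Types (T U : tpow R (idx d) n).

Definition gluew (x : {ffun 'I_n -> X}) (y : {ffun 'I_n -> Y}) : {ffun 'I_n -> idx d} :=
  [ffun i => glue (x i) (y i)].

Lemma sum_gluew (K : nmodType) (F : {ffun 'I_n -> idx d} -> K) :
  \sum_z F z = \sum_x \sum_y F (gluew x y).
Proof.
rewrite (pair_bigA _ (fun x y => F (gluew x y))) /=.
rewrite (reindex (fun p : {ffun 'I_n -> X} * {ffun 'I_n -> Y} => gluew p.1 p.2)) //.
exists (fun z : {ffun 'I_n -> idx d} =>
  ([ffun i => resS S (z i)], [ffun i => resS (~: S) (z i)])) => [[x y] _|z _] /=.
  by congr pair; apply/ffunP => i; rewrite !ffunE ?resS_glueL ?resS_glueR.
by apply/ffunP => i; rewrite !ffunE glue_resS.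
Qed.

Definition slice T (y : {ffun 'I_n -> Y}) : tpow R X n :=
  [ffun x : {ffun 'I_n -> X} => T (gluew x y)].

Fact slice_linear y : linear (fun T => slice T y).
Proof. by move=> c T U; apply/ffunP => x; rewrite !ffunE. Qed.

Lemma sliceP T U : (forall y, slice T y = slice U y) -> T = U.
Proof.
move=> e; apply/ffunP => z.
have -> : z = gluew [ffun i => resS S (z i)] [ffun i => resS (~: S) (z i)].
  by apply/ffunP => i; rewrite !ffunE glue_resS.
set x := finfun _; set y := finfun _.
by have /ffunP/(_ x) := e y; rewrite !ffunE.
Qed.

Lemma dot_slice T U : dot T U = \sum_y dot (slice T y) (slice U y).
Proof.
rewrite /dot sum_gluew exchange_big /=; apply: eq_bigr => y _.
by apply: eq_bigr => x _; rewrite !ffunE.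
Qed.

Lemma slice_ext_id P T y : slice (ext_id P T) y = P (slice T y).
Proof.
apply/ffunP => x; rewrite !ffunE; congr (P _ _); last first.
  by apply/ffunP => i; rewrite !ffunE resS_glueL.
apply/ffunP => x'; rewrite !ffunE; congr (T _); apply/ffunP => i.
by rewrite !ffunE resS_glueR.
Qed.

Lemma slice_sact p T y :
  slice (sact p T) y = sact p (slice T [ffun i => y (p i)]).
Proof.
apply/ffunP => x; rewrite !ffunE; congr (T _); apply/ffunP => i.
by rewrite !ffunE.
Qed.

(** The part of [bproj] that remains on permutation-invariant tensors, where the symmetriser is the
    identity. *)
Definition extp la T : tpow R (idx d) n := ext_id (linfun (@pact R n X la)) T.

Lemma slice_extp la T y : slice (extp la T) y = pact la (slice T y).
Proof. by rewrite /extp slice_ext_id lfunE. Qed.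

Fact extp_linear la : linear (extp la).
Proof.
move=> c T U; apply: sliceP => y; rewrite slice_linear !slice_extp.
by rewrite slice_linear linearP.
Qed.
HB.instance Definition _ la :=
  GRing.isLinear.Build C _ _ _ (extp la) (extp_linear la).

Lemma slice_sum (J : Type) (s : seq J) (P : pred J) F y :
  slice (\sum_(j <- s | P j) F j) y = \sum_(j <- s | P j) slice (F j) y.
Proof.
apply: (big_morph (fun T => slice T y)) => [T U|].
  by apply/ffunP => x; rewrite !ffunE.
by apply/ffunP => x; rewrite !ffunE.
Qed.

Lemma extp_sum T : \sum_(la <- cycle_types n) extp la T = T.
Proof.
apply: sliceP => y; rewrite slice_sum -[RHS]pact_sum.
by apply: eq_bigr => la _; rewrite slice_extp.
Qed.

Lemma slice0 y : slice 0 y = 0.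
Proof. by apply/ffunP => x; rewrite !ffunE. Qed.

Lemma extp_ortho la mu T : la \in cycle_types n -> mu \in cycle_types n ->
  la != mu -> extp la (extp mu T) = 0.
Proof.
by move=> *; apply: sliceP => y; rewrite !slice_extp slice0 pact_ortho.
Qed.

Lemma extp_idem la T : la \in cycle_types n -> extp la (extp la T) = extp la T.
Proof. by move=> laL; apply: sliceP => y; rewrite !slice_extp pact_idem. Qed.

Lemma dot_extp la T U : la \in cycle_types n -> dot (extp la T) U = dot T (extp la U).
Proof.
move=> laL; rewrite !dot_slice; apply: eq_bigr => y _.
by rewrite !slice_extp dot_pact.
Qed.

Lemma extp_sact la p T : extp la (sact p T) = sact p (extp la T).
Proof.
by apply: sliceP => y; rewrite !(slice_extp, slice_sact) pact_sact.
Qed.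

End Glue.

(** * Products of almost trivial projections *)

Section GentleMeasurement.
Variables (R : realType) (I : finType) (J : eqType).
Local Notation C := (R[i]).
Local Notation W := (cspace R I).
Variable Q : J -> {linear W -> W}.

Lemma dot_pythagoras (U V : W) : dot U V = 0 -> dot V U = 0 ->
  dot (U + V) (U + V) = dot U U + dot V V.
Proof. by move=> UV VU; rewrite dotDl !dotDr UV VU addr0 add0r. Qed.

(* Orthogonality of [T - Q b T] and the range of [Q b] lets the defects add up
   without any square root. *)
Lemma gentle_measurement (s : seq J) (T : W) :
  (forall b U, b \in s -> Q b (Q b U) = Q b U) ->
  (forall b U V, b \in s -> dot (Q b U) V = dot U (Q b V)) ->
  let T' := foldl (fun U b => Q b U) T s in
  dot (T - T') (T - T') <= \sum_(b <- s) dot (T - Q b T) (T - Q b T).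
Proof.
elim/last_ind: s => [|s b IHs] idem adj /=.
  by rewrite subrr dot0l big_nil.
have bs : b \in rcons s b by rewrite mem_rcons inE eqxx.
have sub c : c \in s -> c \in rcons s b by rewrite mem_rcons inE => ->; rewrite orbT.
have {}IHs := IHs (fun c U h => idem c U (sub c h)) (fun c U V h => adj c U V (sub c h)).
rewrite foldl_rcons -cats1 big_cat big_seq1 /= addrC.
set T' := foldl _ _ _ in IHs *.
pose A := T - Q b T; pose D := T - T'.
have QA : Q b A = 0 by rewrite /A linearB /= idem // subrr.
have -> : T - Q b T' = A + Q b D.
  by rewrite /A /D linearB /= addrA subrK.
have ->: dot (A + Q b D) (A + Q b D) = dot A A + dot (Q b D) (Q b D).
  have AQ : dot A (Q b D) = 0 by rewrite -adj // QA dot0l.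
  have QA' : dot (Q b D) A = 0 by rewrite adj // QA dot0r.
  exact: dot_pythagoras.
(* It remains to see that an orthogonal projection does not increase the norm. *)
rewrite lerD2l; apply: le_trans IHs; rewrite -/D.
have DQ : dot D (Q b D) = dot (Q b D) (Q b D) by rewrite [RHS]adj // idem.
have QD : dot (Q b D) D = dot (Q b D) (Q b D) by rewrite [LHS]adj.
have := dot_ge0 (D - Q b D); rewrite dotBl (dotBr D) (dotBr (Q b D)) DQ QD.
by rewrite subrr subr0 subr_ge0.
Qed.

End GentleMeasurement.

(** * Selecting a nonzero term from a product of sums *)

Section Choose.
Variables (K : pzRingType) (W : lmodType K) (J : eqType) (L : eqType).
Variables (P : J -> L -> {linear W -> W}) (Ls : J -> seq L) (l0 : L).

(** By linearity the iterated sum splits along the first index; if every term vanished, so would the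
    total. As [s] has no repetition, the choice at its head does not disturb the later ones. *)
Lemma foldl_choose (s : seq J) (T : W) : uniq s ->
  foldl (fun U b => \sum_(l <- Ls b) P b l U) T s != 0 ->
  exists la : J -> L, (forall b, b \in s -> la b \in Ls b) /\
    foldl (fun U b => P b (la b) U) T s != 0.
Proof.
have lin r (E : J -> W -> W) (F : L -> W) :
    (forall b U V, E b (U + V) = E b U + E b V) -> (forall b, E b 0 = 0) ->
    forall ls, foldl (fun U b => E b U) (\sum_(l <- ls) F l) r =
    \sum_(l <- ls) foldl (fun U b => E b U) (F l) r.
  move=> ED E0; elim: r F => [|b r IHr] F ls //=; rewrite -IHr.
  by congr foldl; rewrite (big_morph (E b) (ED b) (E0 b)).
elim: s T => [|b s IHs] T /=; first by move=> _ h; exists (fun=> l0).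
move=> /andP[bs us]; rewrite lin; first last.
- by move=> c; apply: big1 => l _; rewrite linear0.
- by move=> c U V; rewrite -big_split; apply: eq_bigr => l _; rewrite linearD.
move=> ne; have [l lL hl] : exists2 l, l \in Ls b &
    foldl (fun U b => \sum_(l <- Ls b) P b l U) (P b l T) s != 0.
  apply: contrapT => nex; case/eqP: ne; apply: big1_seq => l /andP[_ lL].
  by apply/eqP/negPn/negP => h; apply: nex; exists l.
have [la [laP hla]] := IHs _ us hl.
exists (fun c => if c == b then l else la c); rewrite eqxx; split.
  move=> c; rewrite inE; case: eqP => [-> //|_ /=]; exact: laP.
suff -> : foldl (fun U c => P c (if c == b then l else la c) U) (P b l T) s =
          foldl (fun U c => P c (la c) U) (P b l T) s by [].
elim: s bs {IHs us hl laP hla ne} (P b l T) => //= c s IHs.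
rewrite inE negb_or => /andP[bc bs] U; rewrite eq_sym (negPf bc); exact: IHs.
Qed.

End Choose.

(** * Local linear maps commute with the projections *)

Section LocalAction.
Variables (R : realType) (k : nat) (d : 'I_k -> nat).
Local Notation C := (R[i]).

Lemma local_act_inv (A : forall j, 'M[C]_(d j)) (t : tensor R d) :
  (forall j, A j \in unitmx) ->
  local_act (fun j => invmx (A j)) (local_act A t) = t.
Proof.
move=> uA; apply/ffunP => x; rewrite ffunE.
under eq_bigr => y _ do rewrite ffunE mulr_sumr.
rewrite exchange_big /=.
have E (z : idx d) : \sum_(y : idx d)
    \prod_j (invmx (A j) (x j) (y j) * A j (y j) (z j)) = (x == z)%:R.
  rewrite (sum_prod_dffun (fun j (l : 'I_(d j)) => invmx (A j) (x j) l * A j l (z j))).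
  have I1 j : \sum_(l : 'I_(d j)) invmx (A j) (x j) l * A j l (z j) = (x j == z j)%:R.
    have := congr1 (fun M : 'M_(d j) => M (x j) (z j)) (mulVmx (uA j)).
    by rewrite !mxE.
  under eq_bigr => j _ do rewrite I1.
  have [->|ne] := eqVneq x z; first by rewrite big1 // => j _; rewrite eqxx.
  have /existsP[j /negPf xz] : [exists j, x j != z j].
    rewrite -negb_forall; apply: contra ne => /forallP h.
    by apply/eqP/ffunP => j; apply/eqP.
  by rewrite (bigD1 j) //= xz mul0r.
transitivity (\sum_z (x == z)%:R * t z).
  apply: eq_bigr => z _; rewrite -E mulr_suml; apply: eq_bigr => y _.
  by rewrite mulrA big_split.
rewrite (bigD1 x) //= big1 ?addr0 ?eqxx ?mul1r // => z zx.
by rewrite eq_sym (negPf zx) mul0r.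
Qed.

Lemma local_act0 (A : forall j, 'M[C]_(d j)) : local_act A 0 = 0.
Proof. by apply/ffunP => x; rewrite !ffunE big1 // => y _; rewrite ffunE mulr0. Qed.

Lemma local_act_neq0 (A : forall j, 'M[C]_(d j)) (t : tensor R d) :
  (forall j, A j \in unitmx) -> t != 0 -> local_act A t != 0.
Proof.
by move=> uA; apply: contraNneq => e; rewrite -(local_act_inv t uA) e local_act0.
Qed.

Variables (n : nat) (A : forall j, 'M[C]_(d j)).
Implicit Types T : tpow R (idx d) n.

Definition local_actn T : tpow R (idx d) n :=
  [ffun x : {ffun 'I_n -> idx d} => \sum_(y : {ffun 'I_n -> idx d})
     (\prod_i \prod_j A j (x i j) (y i j)) * T y].

Lemma local_actn0 : local_actn 0 = 0.
Proof. by apply/ffunP => x; rewrite !ffunE big1 // => y _; rewrite ffunE mulr0. Qed.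

Lemma tensor_pow_local_act (t : tensor R d) :
  tensor_pow n (local_act A t) = local_actn (tensor_pow n t).
Proof.
apply/ffunP => x; rewrite !ffunE.
under eq_bigr => i _ do rewrite ffunE.
rewrite -sum_prod_ffun; apply: eq_bigr => y _.
by rewrite ffunE -big_split.
Qed.

(** The map factors over [S] and its complement: the complement only mixes slices with scalar
    coefficients, while [S] acts on each slice by a tensor power, which commutes with [pact]. *)
Lemma slice_local_actn (S : {set 'I_k}) T (y : {ffun 'I_n -> idxS d (~: S)}) :
  slice (local_actn T) y = \sum_(y' : {ffun 'I_n -> idxS d (~: S)})
   (\prod_i \prod_(j : {j | j \in ~: S}) A (val j) (y i j) (y' i j)) *:
     glact (\matrix_(a, b) \prod_(j : {j | j \in S})
         A (val j) ((enum_val a : idxS d S) j) ((enum_val b : idxS d S) j)) (slice T y').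
Proof.
apply/ffunP => x; rewrite !ffunE (sum_gluew S) exchange_big sum_ffunE /=.
apply: eq_bigr => y' _; rewrite !ffunE [RHS]mulr_sumr; apply: eq_bigr => x' _.
rewrite !ffunE mulrA; congr (_ * _); rewrite mulrC -big_split /=.
apply: eq_bigr => i _; rewrite !ffunE mxE !enum_rankK.
exact: (prod_glue (fun j => A j)).
Qed.

Lemma extp_local_actn (S : {set 'I_k}) la T :
  extp S la (local_actn T) = local_actn (extp S la T).
Proof.
apply: (@sliceP _ _ S) => y; rewrite slice_extp !slice_local_actn linear_sum.
apply: eq_bigr => y' _ /=; rewrite linearZ /= slice_extp.
by rewrite /pact galgact_glact.
Qed.

End LocalAction.

(** * The upper and lower quantum functionals *)

Section Bipartitions.
Variables (R : realType) (k : nat) (d : 'I_k -> nat).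
Local Notation C := (R[i]).

Section FixedPower.
Variable n : nat.
Implicit Types T : tpow R (idx d) n.

Lemma bprojE (b : bipartition k) la T : la \in cycle_types n ->
  (forall p, sact p T = T) -> bproj b la T = extp (side b) la T.
Proof.
move=> laL sT; rewrite /bproj isoprojE // /extp; congr ext_id.
by rewrite /symmetriser (eq_bigr (fun=> T)) ?sum_const.
Qed.

(** Every intermediate tensor stays permutation-invariant by [extp_sact], so each symmetriser acts
    as the identity. *)
Lemma foldl_bproj (s : seq (bipartition k)) (la : bipartition k -> seq nat) T :
  (forall b, b \in s -> la b \in cycle_types n) -> (forall p, sact p T = T) ->
  foldl (fun U b => bproj b (la b) U) T s =
  foldl (fun U b => extp (side b) (la b) U) T s.
Proof.
elim: s T => //= b s IHs T laP sT.
rewrite bprojE ?laP ?mem_head //; apply: IHs => [c cs|p].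
  by apply: laP; rewrite inE cs orbT.
by rewrite -extp_sact sT.
Qed.

Lemma sact_tensor_pow (t : tensor R d) p : sact p (tensor_pow n t) = tensor_pow n t.
Proof.
apply/ffunP => x; rewrite !ffunE [RHS](reindex_inj (@perm_inj _ p)) /=.
by apply: eq_bigr => i _; rewrite ffunE.
Qed.

Lemma foldl_extp_local_actn A (s : seq (bipartition k))
    (la : bipartition k -> seq nat) T :
  foldl (fun U b => extp (side b) (la b) U) (local_actn A T) s =
  local_actn A (foldl (fun U b => extp (side b) (la b) U) T s).
Proof. by elim: s T => //= b s IHs T; rewrite extp_local_actn IHs. Qed.

Definition goodp (S : {set 'I_k}) (good : pred (seq nat)) T : tpow R (idx d) n :=
  \sum_(la <- [seq la <- cycle_types n | good la]) extp S la T.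

Fact goodp_linear S good : linear (goodp S good).
Proof.
move=> c T U; rewrite /goodp scaler_sumr -big_split; apply: eq_bigr => la _ /=.
by rewrite linearP.
Qed.
HB.instance Definition _ S good :=
  GRing.isLinear.Build C _ _ _ (goodp S good) (goodp_linear S good).

Lemma goodp_idem S good T : goodp S good (goodp S good T) = goodp S good T.
Proof.
rewrite {1 3}/goodp; apply: eq_big_seq => la laG.
have laL : la \in cycle_types n by move: laG; rewrite mem_filter => /andP[].
rewrite /goodp linear_sum /= (bigD1_seq la) ?filter_uniq ?undup_uniq //=.
rewrite -[RHS]addr0; congr (_ + _); first exact: (extp_idem S T laL).
apply: big1_seq => mu; rewrite mem_filter => /andP[ne /andP[_ muL]].
by apply: extp_ortho => //; rewrite eq_sym.
Qed.

Lemma dot_goodp S good T U : dot (goodp S good T) U = dot T (goodp S good U).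
Proof.
rewrite /goodp dot_suml dot_sumr; apply: eq_big_seq => la.
by rewrite mem_filter => /andP[_ laL]; exact: dot_extp.
Qed.

(** The defect is the sum of the components outside [good], and these are mutually orthogonal. *)
Lemma dot_goodp_defect S good T :
  dot (T - goodp S good T) (T - goodp S good T) =
  \sum_(la <- cycle_types n | ~~ good la) dot (extp S la T) (extp S la T).
Proof.
have DE : T - goodp S good T = \sum_(la <- cycle_types n | ~~ good la) extp S la T.
  by rewrite -{1}(extp_sum S T) (bigID good) /= /goodp big_filter addrAC subrr add0r.
have G0 : dot (goodp S good T) (T - goodp S good T) = 0.
  by rewrite dot_goodp linearB /= goodp_idem subrr dot0r.
rewrite dotBl G0 subr0 DE dot_sumr big_seq_cond [RHS]big_seq_cond.
apply: eq_bigr => la /andP[laL _].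
by rewrite dot_extp // extp_idem.
Qed.

End FixedPower.

Definition bimatrix (S : {set 'I_k}) (psi : tensor R d) (x : idxS d S)
  (y : idxS d (~: S)) : C := psi (glue x y).

Lemma vnorm_bimatrix S psi : vnorm (@bimatrix S psi) = dot psi psi.
Proof. by rewrite /vnorm /dot (sum_glue S). Qed.

Lemma vmarg_bimatrix S psi : vmarg (@bimatrix S psi) = marginal psi S.
Proof.
apply/matrixP => a b; rewrite !mxE; apply: eq_bigr => c _.
by rewrite vnorm_bimatrix.
Qed.

Lemma slice_tensor_pow n S psi (y : {ffun 'I_n -> idxS d (~: S)}) :
  slice (tensor_pow n psi) y = vpow (@bimatrix S psi) y.
Proof.
by apply/ffunP => x; rewrite !ffunE; apply: eq_bigr => i _; rewrite ffunE.
Qed.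

Lemma dot_tensor_pow n (psi : tensor R d) :
  dot (tensor_pow n psi) (tensor_pow n psi) = dot psi psi ^+ n.
Proof.
rewrite /dot -[in RHS](card_ord n) -prodr_const -sum_prod_ffun.
by apply: eq_bigr => x _; rewrite !ffunE rmorph_prod -big_split.
Qed.

(** For large [n] the projections onto the components of large entropy move the tensor power so
    little that their product does not kill it; [foldl_choose] then picks one partition per
    bipartition. *)
Lemma typical_parts_exist (s : seq (bipartition k)) (psi : tensor R d) (eps : R) :
  uniq s -> psi != 0 -> 0 < eps ->
  exists n, exists la : bipartition k -> seq nat,
    [/\ (1 <= n)%N, forall b, b \in s -> la b \in cycle_types n,
        forall b, b \in s ->
          vN_entropy (marginal psi (side b)) - eps <= shannon_part R n (la b)
      & foldl (fun U b => extp (side b) (la b) U) (tensor_pow n psi) s != 0].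
Proof.
move=> us psi0 eps0; pose H b := vN_entropy (marginal psi (side b)).
have N0 : dot psi psi != 0 by rewrite dot_eq0.
have Npos : 0 < dot psi psi by rewrite lt_def N0 dot_ge0.
(* With this share for each bipartition, the total defect is a fraction of the squared norm strictly
   below 1. *)
pose eta : R := (size s).+1%:R^-1.
have eta0 : 0 < eta by rewrite invr_gt0 ltr0n.
have small (b : bipartition k) : exists N, forall n, (N <= n)%N ->
   \sum_(la <- cycle_types n | shannon_part R n la <= H b - eps)
     dot (extp (side b) la (tensor_pow n psi)) (extp (side b) la (tensor_pow n psi))
     <= dot psi psi ^+ n * eta%:C.
  have V0 : vnorm (@bimatrix (side b) psi) != 0 by rewrite vnorm_bimatrix.
  have [N hN] := bad_weight_small V0 eps0 eta0; exists N => n nN.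
  have := hN n nN; rewrite vmarg_bimatrix vnorm_bimatrix; apply: le_trans.
  rewrite le_eqVlt; apply/orP; left; apply/eqP/eq_bigr => la _.
  rewrite (dot_slice (side b)); apply: eq_bigr => y _.
  by rewrite slice_extp slice_tensor_pow.
pose Nf b := projT1 (cid (small b)).
have Nfle b n : (Nf b <= n)%N -> _ := projT2 (cid (small b)) n.
(* One exponent beyond all thresholds; the successor makes it positive. *)
pose n := (\max_b Nf b).+1.
have nN b : (Nf b <= n)%N by rewrite leqW // leq_bigmax.
pose good b la := ~~ (shannon_part R n la <= H b - eps).
pose Q b : {linear tpow R (idx d) n -> tpow R (idx d) n} := goodp (side b) (good b).
have gentle := @gentle_measurement R _ _ Q s (tensor_pow n psi)
  (fun b U _ => goodp_idem _ _ U) (fun b U V _ => dot_goodp _ _ U V).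
(* If the product vanished, its defect would be the full squared norm, contradicting the bound
   [gentle]. *)
have ne0 : foldl (fun U b => Q b U) (tensor_pow n psi) s != 0.
  apply/eqP => e; move: gentle; rewrite e /= subr0 dot_tensor_pow; apply/negP.
  rewrite -real_ltNge ?ger0_real ?exprn_ge0 ?dot_ge0 //; last first.
    by apply: sumr_ge0 => b _; exact: dot_ge0.
  apply: (@le_lt_trans _ _ (\sum_(b <- s) dot psi psi ^+ n * eta%:C)).
    apply: ler_sum => b _; rewrite dot_goodp_defect.
    apply: le_trans (Nfle b n (nN b)); rewrite le_eqVlt; apply/orP; left.
    by apply/eqP/eq_bigl => la; rewrite /good negbK.
  rewrite big_const_seq count_predT iter_addr_0 -mulr_natr -mulrA.
  rewrite -[ltRHS]mulr1 ltr_pM2l ?exprn_gt0 //.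
  rewrite -(rmorph_nat (real_complex R)) -rmorphM -(rmorph1 (real_complex R)) ltcR.
  by rewrite mulrC ltr_pdivrMr ?ltr0n // mul1r ltr_nat.
have [la [laP hla]] := @foldl_choose C (tpow R (idx d) n) _ _
  (fun b la => @extp k d (side b) R n la) (fun b => [seq la <- cycle_types n | good b la])
  [::] s (tensor_pow n psi) us ne0.
exists n, la; split=> // b /laP; rewrite mem_filter => /andP[gb laL] //.
by move: gb; rewrite /good -ltNge => /ltW.
Qed.

End Bipartitions.

Theorem theorem3p24 (R : realType) (k : nat) (d : 'I_k -> nat)
    (theta : {ffun bipartition k -> R}) (s : seq (bipartition k))
    (t : tensor R d) :
  (3 <= k)%N ->
  is_prob theta ->
  uniq s ->
  s =i [pred b | theta b != 0] ->
  (E_upper theta s t >= E_lower theta t)%E.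
Proof.
move=> _ [th0 th1] us sE; rewrite /E_lower /E_upper; case: eqP => // /eqP t0.
have sum_s (F : bipartition k -> R) :
    \sum_(b <- s) theta b * F b = \sum_b theta b * F b.
  rewrite big_uniq // [RHS](bigID (mem s)) /= [X in _ = _ + X]big1 ?addr0 // => b.
  by rewrite sE inE negbK => /eqP ->; rewrite mul0r.
(* For each [A] the partitions reach the entropies only up to [eps], so the comparison with the
   supremum is made with arbitrary positive slack. *)
apply: ub_ereal_sup => _ [A [uA ->]]; apply/lee_addgt0Pr => eps eps0.
have [n [la [n1 laL laH ne]]] :=
  typical_parts_exist us (local_act_neq0 uA t0) eps0.
rewrite -leeBlDr //; apply: ereal_sup_ge.
exists (\sum_(b <- s) theta b * shannon_part R n (la b))%:E => /=.
  exists n, la; split=> //.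
    by move=> b bs; exact: cycle_types_part (laL b bs).
  rewrite foldl_bproj //; last exact: sact_tensor_pow.
  (* The iterated projection of the power of [local_act A t] is the image under [A] of that of the
     power of [t], so the latter cannot vanish. *)
  apply: contraNneq ne; rewrite tensor_pow_local_act foldl_extp_local_actn => ->.
  by rewrite local_actn0.
rewrite -EFinB lee_fin /H_theta.
(* Since [theta] has total mass 1, the single [eps] can be distributed over the bipartitions. *)
have -> : \sum_b theta b * vN_entropy (marginal (local_act A t) (side b)) - eps =
    \sum_b theta b * (vN_entropy (marginal (local_act A t) (side b)) - eps).
  rewrite -[X in _ - X = _]mul1r -th1 mulr_suml -sumrB.
  by apply: eq_bigr => b _; rewrite mulrBr.
rewrite -sum_s big_seq [leRHS]big_seq; apply: ler_sum => b bs.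
by rewrite ler_wpM2l // laH.
Qed.
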